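(* Let $\mathcal{A}$ be a dual Banach algebra with identity $e$ and predual $\mathcal{A}_*$. The following conditions are equivalent. (i) $\mathcal{A}$ is approximately Connes-amenable. (ii) There is an approximate $\sigma WC$-virtual diagonal for $\mathcal{A}$.
   Context: Derivations are bounded. For a Banach $\mathcal{A}$-bimodule $\mathcal{X}$, the dual $\mathcal{X}^*$ is a bimodule via $\langle \phi.a,x\rangle=\langle\phi,a.x\rangle$, $\langle a.\phi,x\rangle=\langle\phi,x.a\rangle$; a dual Banach $\mathcal{A}$-bimodule is one of the form $\mathcal{X}=(\mathcal{X}_* )^*$ for a Banach bimodule $\mathcal{X}_*$. A Banach algebra $\mathcal{A}$ is a dual Banach algebra if there is a closed submodule $\mathcal{A}_*$ of $\mathcal{A}^*$ with $\mathcal{A}=(\mathcal{A}_* )^*$; the predual is fixed, and $\omega^*$ on $\mathcal{A}$ means $\sigma(\mathcal{A},\mathcal{A}_* )$. A dual Banach bimodule $\mathcal{X}$ is normal if for every $x\in\mathcal{X}$ the maps $a\mapsto a.x$ and $a\mapsto x.a$ from $\mathcal{A}$ to $\mathcal{X}$ are $\omega^*$-$\omega^*$ continuous. A derivation $D:\mathcal{A}\to\mathcal{X}$ is approximately inner if there is a (not necessarily bounded) net $(x_\alpha)\subseteq\mathcal{X}$ with $D(a)=\lim_\alpha(a.x_\alpha-x_\alpha.a)$ in norm for every $a\in\mathcal{A}$. $\mathcal{A}$ is approximately Connes-amenable if for every normal dual Banach $\mathcal{A}$-bimodule $\mathcal{X}$, every $\omega^*$-$\omega^*$ continuous derivation $D:\mathcal{A}\to\mathcal{X}$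 is approximately inner. For a Banach $\mathcal{A}$-bimodule $\mathcal{X}$, $\sigma WC(\mathcal{X})$ is the set (a closed submodule) of all $x\in\mathcal{X}$ such that the maps $a\mapsto a.x$ and $a\mapsto x.a$ from $\mathcal{A}$ to $\mathcal{X}$ are continuous from the $\omega^*$-topology of $\mathcal{A}$ to the weak topology $\sigma(\mathcal{X},\mathcal{X}^* )$. Let $\mathcal{A}\widehat{\otimes}\mathcal{A}$ be the projective tensor product with bimodule actions $a.(b\otimes c)=ab\otimes c$, $(b\otimes c).a=b\otimes ca$, and $\Delta:\mathcal{A}\widehat{\otimes}\mathcal{A}\to\mathcal{A}$, $a\otimes b\mapsto ab$. It is known that $\Delta^*$ maps $\mathcal{A}_*$ into $\sigma WC((\mathcal{A}\widehat{\otimes}\mathcal{A})^* )$; define the bimodule homomorphism $\Delta_{\sigma WC}:\sigma WC((\mathcal{A}\widehat{\otimes}\mathcal{A})^* )^*\to\mathcal{A}$ by $\langle\Delta_{\sigma WC}(M),\phi\rangle=\langle M,\Delta^*\phi\rangle$ for $\phi\in\mathcal{A}_*$. An approximate $\sigma WC$-virtual diagonal for $\mathcal{A}$ is a net $(M_\alpha)$ in $\sigma WC((\mathcal{A}\widehat{\otimes}\mathcal{A})^* )^*$ such that $a.M_\alpha-M_\alpha.a\to0$ for every $a\in\mathcal{A}$ and $\Delta_{\sigma WC}(M_\alpha)\to e$, both limits in norm. *)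

(* Defs.v *)
From HB Require Import structures.
From mathcomp Require Import all_boot all_order all_algebra.
From mathcomp Require Import all_classical all_reals all_analysis.
From mathcomp.real_closed Require Import complex.

Set Implicit Arguments.
Unset Strict Implicit.
Unset Printing Implicit Defensive.

Import Order.TTheory GRing.Theory Num.Theory.
Import numFieldNormedType.Exports.

Local Open Scope classical_set_scope.
Local Open Scope ring_scope.
Local Open Scope complex_scope.

Section LinearMaps.
Context {R : realType}.
Local Notation C := R[i].

Definition bounded_linear (V W : normedModType C) (f : V -> W) : Prop :=
  linear f /\ exists k : C, forall x, `|f x| <= k * `|x|.

Definition bounded_bilinear (U V W : normedModType C) (B : U -> V -> W) : Prop :=
  [/\ forall x, linear (B x), forall y, linear (B ^~ y) &
      exists k : C, forall x y, `|B x y| <= k * `|x| * `|y|].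

Section Linear.
Variables (V W : lmodType C) (f : V -> W).
Hypothesis fl : linear f.

Lemma linear_D x y : f (x + y) = f x + f y.
Proof. by have := fl 1 x y; rewrite !scale1r. Qed.

Lemma linear_0 : f 0 = 0.
Proof.
have /eqP := linear_D 0 0.
by rewrite addr0 -subr_eq0 opprD addNKr oppr_eq0 => /eqP.
Qed.

Lemma linear_Z a x : f (a *: x) = a *: f x.
Proof. by have := fl a x 0; rewrite linear_0 !addr0. Qed.

Lemma linear_N x : f (- x) = - f x.
Proof. by rewrite -scaleN1r linear_Z scaleN1r. Qed.

Lemma linear_B x y : f (x - y) = f x - f y.
Proof. by rewrite linear_D linear_N. Qed.

End Linear.

Section Norms.
Variables (V W : normedModType C).

(* Norms over [R[i]] take their values in [R[i]]; [rnorm] is the same number in [R]. *)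
Definition rnorm (x : V) : R := complex.Re `|x|.

Lemma Re_ge0K (z : C) : 0 <= z -> (complex.Re z)%:C = z.
Proof. by move=> z0; exact: RRe_real (ger0_real z0). Qed.

Lemma rnormE x : (rnorm x)%:C = `|x|.
Proof. exact: Re_ge0K. Qed.

Lemma rnorm_ge0 x : 0 <= rnorm x.
Proof. by rewrite -lecR rnormE; exact: normr_ge0. Qed.

Lemma bounded_linear_real (f : V -> W) : bounded_linear f ->
  exists2 k : R, 0 <= k & forall x, `|f x| <= k%:C * `|x|.
Proof.
move=> [_ [k fk]]; exists (complex.Re `|k|).
  by rewrite -lecR Re_ge0K //; exact: normr_ge0.
move=> x; rewrite Re_ge0K //.
apply: (le_trans (fk x)); rewrite -[`|x| in leRHS]normr_id -normrM ger0_norm //.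
by rewrite (le_trans _ (fk x)).
Qed.

Lemma bounded_linear_comb (a : C) (f g : V -> W) :
  bounded_linear f -> bounded_linear g -> bounded_linear (a *: f + g).
Proof.
move=> bf bg; have [k k0 fk] := bounded_linear_real bf.
have [l l0 gl] := bounded_linear_real bg.
case: bf bg => fl _ [gl' _]; split.
  move=> b x y; rewrite !fctE fl gl' !scalerDr !scalerA mulrC !addrA; congr (_ + _).
  by rewrite -!addrA; congr (_ + _); rewrite addrC.
exists (`|a| * k%:C + l%:C) => x; rewrite !fctE.
apply: (le_trans (ler_normD _ _)); rewrite mulrDl lerD // normrZ -mulrA.
by rewrite ler_wpM2l.
Qed.

End Norms.

Lemma bounded_linear_comp (U V W : normedModType C) (g : V -> W) (f : U -> V) :
  bounded_linear g -> bounded_linear f -> bounded_linear (g \o f).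
Proof.
move=> bg bf; have [k k0 fk] := bounded_linear_real bf.
have [l l0 gl] := bounded_linear_real bg.
case: bf bg => fl _ [gl' _]; split; first by move=> a x y /=; rewrite fl gl'.
exists (l%:C * k%:C) => x /=; apply: (le_trans (gl _)).
by rewrite -mulrA ler_wpM2l // lecR.
Qed.

Lemma bounded_bilinear_real (U V W : normedModType C) (B : U -> V -> W) :
  bounded_bilinear B ->
  exists2 k : R, 0 <= k & forall x y, `|B x y| <= k%:C * `|x| * `|y|.
Proof.
move=> [_ _ [k Bk]]; exists (complex.Re `|k|).
  by rewrite -lecR Re_ge0K //; exact: normr_ge0.
move=> x y; rewrite Re_ge0K // -mulrA.
have xy0 : 0 <= `|x| * `|y| by rewrite mulr_ge0.
apply: (le_trans (Bk x y)); rewrite -mulrA -[`|x| * `|y| in leRHS]ger0_norm //.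
rewrite -normrM ger0_norm //.
by rewrite mulrA (le_trans _ (Bk x y)).
Qed.

Lemma bounded_bilinearr (U V W : normedModType C) (B : U -> V -> W) x :
  bounded_bilinear B -> bounded_linear (B x).
Proof. by move=> [Bl _ [k Bk]]; split=> //; exists (k * `|x|). Qed.

Lemma bounded_bilinearl (U V W : normedModType C) (B : U -> V -> W) y :
  bounded_bilinear B -> bounded_linear (B ^~ y).
Proof.
move=> [_ Bl [k Bk]]; split=> //; exists (k * `|y|) => x.
by rewrite mulrAC.
Qed.

End LinearMaps.

Section Dual.
Context {R : realType}.
Local Notation C := R[i].
Variable V : normedModType C.

Definition functional : {pred V -> C^o} := fun f => `[< bounded_linear f >].

Lemma functional_submod_closed : submod_closed functional.
Proof.
split.
  apply/asboolP; split; first by move=> a x y; rewrite /= scaler0 addr0.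
  by exists 0 => x; rewrite normr0 mul0r.
move=> a f g /asboolP bf /asboolP bg; apply/asboolP.
exact: bounded_linear_comb.
Qed.

HB.instance Definition _ :=
  GRing.isSubmodClosed.Build C (V -> C^o) functional functional_submod_closed.

Definition dual := {f : V -> C^o | functional f}.

HB.instance Definition _ := SubChoice.on dual.
HB.instance Definition _ := [SubChoice_isSubLmodule of dual by <:].

Definition dual_fun (phi : dual) : V -> C^o := val phi.
Coercion dual_fun : dual >-> Funclass.

Lemma dual_bounded (phi : dual) : bounded_linear phi.
Proof. by case: phi => f pf; exact: (asboolW pf). Qed.

Lemma dual_linear (phi : dual) : linear phi.
Proof. by case: (dual_bounded phi). Qed.

Lemma dual_ext (phi psi : dual) : (forall x, phi x = psi x) -> phi = psi.
Proof. by move=> eq; apply/val_inj/funext. Qed.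

Lemma dual_comb (a : C) (phi psi : dual) x :
  dual_fun (a *: phi + psi) x = a *: (phi x : C^o) + psi x.
Proof. by []. Qed.

Definition mk_dual (f : V -> C^o) (bf : bounded_linear f) : dual :=
  exist _ f (asboolT bf).

(* The usual dual norm: the supremum of [|phi x|] over the closed unit ball. *)
Definition opnorm (phi : dual) : C :=
  (sup [set rnorm (phi x : C^o) | x in [set x : V | `|x| <= 1]])%:C.

Lemma opnorm_has_sup (phi : dual) :
  has_sup [set rnorm (phi x : C^o) | x in [set x : V | `|x| <= 1]].
Proof.
split; first by exists (rnorm (phi 0)), 0 => //=; rewrite normr0 ler01.
have [k k0 fk] := bounded_linear_real (dual_bounded phi).
exists k => _ [x /= x1 <-]; rewrite -lecR rnormE.
by apply: (le_trans (fk x)); rewrite -[leRHS]mulr1 ler_wpM2l // lecR.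
Qed.

Lemma opnorm_ge0 (phi : dual) : 0 <= opnorm phi.
Proof.
rewrite lecR; apply: (le_trans (rnorm_ge0 (phi 0 : C^o))).
apply: sup_upper_bound; first exact: opnorm_has_sup.
by exists 0 => //=; rewrite normr0 ler01.
Qed.

Lemma opnorm_ub (phi : dual) x : `|phi x| <= opnorm phi * `|x|.
Proof.
have [->|x0] := eqVneq x 0.
  by rewrite (linear_0 (dual_linear phi)) !normr0 mulr0.
have nx0 : 0 < `|x| by rewrite normr_gt0.
rewrite -ler_pdivrMr // mulrC.
have -> : `|x|^-1 * `|phi x| = `|phi (`|x|^-1 *: x)|.
  by rewrite (linear_Z (dual_linear phi)) [_ *: _]/(_ * _) normrM normfV normr_id.
rewrite -[leLHS]rnormE lecR; apply: sup_upper_bound; first exact: opnorm_has_sup.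
by exists (`|x|^-1 *: x) => //=; rewrite normrZ normfV normr_id mulVf ?gt_eqF.
Qed.

Lemma opnorm_le (phi : dual) (k : C) : 0 <= k ->
  (forall x, `|phi x| <= k * `|x|) -> opnorm phi <= k.
Proof.
move=> k0 pk; rewrite -[k]Re_ge0K // lecR; apply: ge_sup.
  by case: (opnorm_has_sup phi).
move=> _ [x /= x1 <-]; rewrite -lecR rnormE Re_ge0K //.
by apply: (le_trans (pk x)); rewrite -[leRHS]mulr1 ler_wpM2l.
Qed.

Lemma opnormD (phi psi : dual) : opnorm (phi + psi) <= opnorm phi + opnorm psi.
Proof.
apply: opnorm_le => [|x]; first by rewrite addr_ge0 // opnorm_ge0.
by rewrite mulrDl (le_trans (ler_normD _ _)) // lerD // opnorm_ub.
Qed.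

Lemma opnormZ_le (a : C) (phi : dual) : opnorm (a *: phi) <= `|a| * opnorm phi.
Proof.
apply: opnorm_le => [|x]; first by rewrite mulr_ge0 // opnorm_ge0.
rewrite -mulrA; have -> : dual_fun (a *: phi) x = a * phi x by [].
by rewrite normrM ler_wpM2l // opnorm_ub.
Qed.

Lemma opnormZ (a : C) (phi : dual) : opnorm (a *: phi) = `|a| * opnorm phi.
Proof.
apply/le_anti; rewrite opnormZ_le /=.
have [->|a0] := eqVneq a 0; first by rewrite normr0 mul0r opnorm_ge0.
rewrite mulrC -ler_pdivlMr ?normr_gt0 // mulrC -normfV.
by rewrite -[in leLHS](scalerK a0 phi) opnormZ_le.
Qed.

Lemma opnorm_eq0 (phi : dual) : opnorm phi = 0 -> phi = 0.
Proof.
move=> p0; apply: dual_ext => x; apply/eqP; rewrite -normr_le0.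
by rewrite (le_trans (opnorm_ub _ _)) // p0 mul0r.
Qed.

HB.instance Definition _ :=
  Lmodule_isNormed.Build C dual opnormD opnormZ opnorm_eq0.

End Dual.

Section Subspace.
Context {R : realType}.
Local Notation C := R[i].
Variables (V : normedModType C) (S : submodClosed V).

Definition subsp := {x : V | x \in S}.

Definition mk_subsp (x : V) (xS : x \in S) : subsp := exist _ x xS.

HB.instance Definition _ := SubChoice.on subsp.
HB.instance Definition _ := [SubChoice_isSubLmodule of subsp by <:].

Lemma subsp_normD (x y : subsp) : `|val (x + y)| <= `|val x| + `|val y|.
Proof. exact: ler_normD. Qed.

Lemma subsp_normZ (a : C) (x : subsp) : `|val (a *: x)| = `|a| * `|val x|.
Proof. exact: normrZ. Qed.

Lemma subsp_norm0 (x : subsp) : `|val x| = 0 -> x = 0.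
Proof. by move=> /eqP; rewrite normr_eq0 => /eqP x0; apply: val_inj. Qed.

HB.instance Definition _ :=
  Lmodule_isNormed.Build C subsp subsp_normD subsp_normZ subsp_norm0.

Lemma subsp_comb (a : C) (x y : subsp) : val (a *: x + y) = a *: val x + val y.
Proof. by []. Qed.

Lemma mk_subsp_comb (a : C) (x y z : V) (xS : x \in S) (yS : y \in S)
    (zS : z \in S) : z = a *: x + y ->
  mk_subsp zS = a *: mk_subsp xS + mk_subsp yS.
Proof. by move=> zE; apply: val_inj. Qed.

Lemma subsp_val_bounded : bounded_linear (val : subsp -> V).
Proof. by split; [exact: subsp_comb | exists 1 => x; rewrite mul1r]. Qed.

Lemma subsp_normE (x : subsp) : `|x| = `|val x|.
Proof. by []. Qed.

End Subspace.

Section Adjoint.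
Context {R : realType}.
Local Notation C := R[i].
Variables (V W : normedModType C) (f : V -> W) (bf : bounded_linear f).

Definition adjoint (phi : dual W) : dual V :=
  mk_dual (bounded_linear_comp (dual_bounded phi) bf).

Lemma adjoint_linear : linear adjoint.
Proof. by move=> a phi psi; apply: dual_ext. Qed.

Lemma adjoint_le (k : C) : 0 <= k -> (forall x, `|f x| <= k * `|x|) ->
  forall phi, `|adjoint phi| <= k * `|phi|.
Proof.
move=> k0 fk phi; apply: opnorm_le => [|x]; first by rewrite mulr_ge0.
rewrite (le_trans (opnorm_ub phi (f x))) // -mulrA mulrCA.
by rewrite ler_wpM2l // opnorm_ge0.
Qed.

Lemma adjoint_bounded : bounded_linear adjoint.
Proof.
split; first exact: adjoint_linear.
have [k k0 fk] := bounded_linear_real bf.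
by exists k%:C; apply: adjoint_le => //; rewrite lecR.
Qed.

End Adjoint.

(* No unit is assumed, so the zero algebra is allowed (the library's [algType]
   is unital and nontrivial). *)
HB.mixin Record isBanachAlgebra (R : realType) A
    & CompleteNormedModule R[i] A := {
  bmul : A -> A -> A;
  bmulA : associative bmul;
  bmul_linearr : forall a : A, linear (bmul a);
  bmul_linearl : forall b : A, linear (bmul ^~ b);
  normr_bmul : forall a b : A, `|bmul a b| <= `|a| * `|b|
}.

#[short(type="banachAlgType")]
HB.structure Definition BanachAlgebra (R : realType) :=
  {A of CompleteNormedModule R[i] A & isBanachAlgebra R A}.

Section Bimodules.
Context {R : realType}.
Local Notation C := R[i].
Variable A : banachAlgType R.

Lemma bmul_bounded : bounded_bilinear (bmul : A -> A -> A).
Proof.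
split; [exact: bmul_linearr | exact: bmul_linearl |].
by exists 1 => a b; rewrite mul1r normr_bmul.
Qed.

(* A Banach bimodule is a [bimodule] on a complete space.  Completeness is not
   required here because [X] is also instantiated with duals and with closed
   subspaces of duals, which are registered only as normed modules. *)
Record bimodule (X : normedModType C) := Bimodule {
  lact : A -> X -> X;
  ract : X -> A -> X;
  lact_bounded : bounded_bilinear lact;
  ract_bounded : bounded_bilinear ract;
  lactA : forall a b x, lact (bmul a b) x = lact a (lact b x);
  ractA : forall x a b, ract x (bmul a b) = ract (ract x a) b;
  lract : forall a x b, ract (lact a x) b = lact a (ract x b)
}.

Definition regular_bimodule : bimodule A.
Proof.
by apply: (@Bimodule A bmul bmul) bmul_bounded bmul_bounded _ _ _;
  move=> a b c; rewrite bmulA.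
Defined.

Section DualBimodule.
Variables (X : normedModType C) (M : bimodule X).

Definition dual_lact (a : A) : dual X -> dual X :=
  adjoint (bounded_bilinearl a (ract_bounded M)).

Definition dual_ract (phi : dual X) (a : A) : dual X :=
  adjoint (bounded_bilinearr a (lact_bounded M)) phi.

Lemma dual_lact_bounded : bounded_bilinear dual_lact.
Proof.
have [Ml Mr _] := ract_bounded M.
have [k k0 Mk] := bounded_bilinear_real (ract_bounded M).
split=> [a|phi a b c|]; first exact: adjoint_linear.
  by apply: dual_ext => x /=; rewrite /dual_fun /= Ml (dual_linear phi).
exists k%:C => a phi; apply: adjoint_le; first by rewrite mulr_ge0 // lecR.
by move=> x; rewrite mulrAC.
Qed.

Lemma dual_ract_bounded : bounded_bilinear dual_ract.
Proof.
have [Ml Mr _] := lact_bounded M.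
have [k k0 Mk] := bounded_bilinear_real (lact_bounded M).
split=> [phi a b c|a|]; last 2 first.
- exact: adjoint_linear.
- exists k%:C => phi a; rewrite mulrAC; apply: adjoint_le => //.
  by rewrite mulr_ge0 // lecR.
by apply: dual_ext => x /=; rewrite /dual_fun /= Mr (dual_linear phi).
Qed.

Definition dual_bimodule : bimodule (dual X).
Proof.
apply: (@Bimodule (dual X) dual_lact dual_ract)
  dual_lact_bounded dual_ract_bounded _ _ _ => [a b phi|phi a b|a phi b];
  apply: dual_ext => x; rewrite /dual_fun /=.
- by rewrite ractA.
- by rewrite lactA.
- exact: (congr1 (dual_fun phi) (lract M b x a)).
Defined.

End DualBimodule.

Section SubBimodule.
Variables (X : normedModType C) (M : bimodule X) (S : submodClosed X).
Hypothesis S_lact : forall a x, x \in S -> lact M a x \in S.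
Hypothesis S_ract : forall x a, x \in S -> ract M x a \in S.

Definition sub_bimodule : bimodule (subsp S).
Proof.
apply: (@Bimodule (subsp S)
  (fun a x => mk_subsp (S_lact a (valP x)))
  (fun x a => mk_subsp (S_ract a (valP x)))).
- have [Ml Mr [k Mk]] := lact_bounded M; split=> [a|x|]; last 1 first.
    by exists k => a x; apply: Mk.
    by move=> b x y; apply: val_inj; apply: Ml.
  by move=> b a c; apply: val_inj; apply: Mr.
- have [Ml Mr [k Mk]] := ract_bounded M; split=> [z|c|]; last 1 first.
    by exists k => x a; apply: Mk.
    by move=> b x y; apply: val_inj; apply: Ml.
  by move=> b a d; apply: val_inj; apply: Mr.
- by move=> a b x; apply: val_inj; apply: lactA.
- by move=> x a b; apply: val_inj; apply: ractA.
- by move=> a x b; apply: val_inj; apply: lract.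
Defined.

End SubBimodule.

End Bimodules.

Section SigmaTopology.
Context {R : realType}.
Local Notation C := R[i].

(* The coarsest topology on [V] making every [ev i] continuous. *)
Definition sigma_topology (V : pointedType) (I : Type) (ev : I -> V -> C^o) :
    topologicalType :=
  sup_topology (fun i : I => Topological.class (initial_topology (ev i))).

Lemma sigma_continuousP (T : topologicalType) (V : pointedType) (I : Type)
    (ev : I -> V -> C^o) (f : T -> V) :
  continuous (f : T -> sigma_topology ev) <->
  forall i, continuous (fun t => ev i (f t) : C^o).
Proof.
split=> [cf i|cf t].
  have cfi : continuous (f : T -> initial_topology (ev i)).
    by move=> t; have /cvg_sup := cf t; exact.
  move=> t; apply: (continuous_comp (cfi t)).
  exact: (@initial_continuous V C^o (ev i)).
apply/cvg_sup => i.
have : continuous (f : T -> initial_topology (ev i)).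
  by apply: continuous_comp_initial; exact: cf.
exact.
Qed.

Lemma continuous_comb (T : topologicalType) (c : C) (f g : T -> C^o) :
  continuous f -> continuous g -> continuous (fun t => c *: f t + g t).
Proof.
move=> cf cg t; apply: cvgD; last exact: cg.
by apply: cvgZ; [exact: cvg_cst | exact: cf].
Qed.

Definition weak_topology (X : normedModType C) : topologicalType :=
  sigma_topology (fun (phi : dual X) (x : X) => phi x).

Definition weak_star_topology (Y : normedModType C) : topologicalType :=
  sigma_topology (fun (y : Y) (x : dual Y) => x y).

End SigmaTopology.


Record net (X : Type) := Net {
  net_index : Type;
  net_le : net_index -> net_index -> Prop;
  net_pt :> net_index -> X;
  net_inhabited : inhabited net_index;
  net_refl : forall i, net_le i i;
  net_trans : forall i j k, net_le i j -> net_le j k -> net_le i k;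
  net_directed : forall i j, exists k, net_le i k /\ net_le j k
}.

(* [f (x i) @[i --> tails x] --> l] is convergence of the net [f (x i)] to [l]. *)
Definition tails (X : Type) (x : net X) : set_system (net_index x) :=
  filter_from setT (fun i => [set j | net_le i j]).
Arguments tails {X} x _.

Instance tails_proper_filter (X : Type) (x : net X) : ProperFilter (tails x).
Proof.
apply: filter_from_proper => [|i _]; last by exists i; exact: net_refl.
have [i0] := net_inhabited x.
apply: filter_from_filter; first by exists i0.
move=> i j _ _; have [k [ik jk]] := net_directed i j.
by exists k => // l /= kl; split; [exact: net_trans ik kl | exact: net_trans jk kl].
Qed.

Section DualBanachAlgebra.
Context {R : realType}.
Local Notation C := R[i].
Variable A : banachAlgType R.

Lemma evaluation_bounded (X : normedModType C) (S : submodClosed (dual X)) (x : X) :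
  bounded_linear (fun phi : subsp S => dual_fun (val phi) x).
Proof.
split; first by move=> a phi psi; rewrite subsp_comb dual_comb.
by exists `|x| => phi; rewrite mulrC; apply: opnorm_ub.
Qed.

Definition evaluation (X : normedModType C) (S : submodClosed (dual X)) (x : X) :
  dual (subsp S) := mk_dual (evaluation_bounded S x).

(* The canonical map of [A] into the dual of its predual is required to be an
   isometric bijection; injectivity follows from [predual_isometry]. *)
Record predual := Predual {
  predual_space :> submodClosed (dual A);
  predual_closed : closed [set phi : dual A | phi \in predual_space];
  predual_lact : forall a phi, phi \in predual_space ->
    lact (dual_bimodule (regular_bimodule A)) a phi \in predual_space;
  predual_ract : forall phi a, phi \in predual_space ->
    ract (dual_bimodule (regular_bimodule A)) phi a \in predual_space;
  predual_isometry : forall a, `|evaluation predual_space a| = `|a|;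
  predual_surj : forall F, exists a, evaluation predual_space a = F
}.

Definition weak_star_alg (Ast : predual) : topologicalType :=
  sigma_topology (fun (phi : subsp Ast) (a : A) => dual_fun (val phi) a).

Lemma weak_star_alg_continuous (Ast : predual) (phi : dual A) : phi \in Ast ->
  continuous (phi : weak_star_alg Ast -> C^o).
Proof.
move=> Aphi.
have idc : continuous (id : weak_star_alg Ast -> weak_star_alg Ast).
  by move=> a; exact: cvg_id.
by have /sigma_continuousP /(_ (mk_subsp Aphi)) := idc.
Qed.

Lemma bmull_weak_star (Ast : predual) (b : A) :
  continuous (bmul b : weak_star_alg Ast -> weak_star_alg Ast).
Proof.
apply/sigma_continuousP => -[phi Aphi] /=.
exact: (weak_star_alg_continuous (predual_ract b Aphi)).
Qed.

Lemma bmulr_weak_star (Ast : predual) (b : A) :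
  continuous (bmul ^~ b : weak_star_alg Ast -> weak_star_alg Ast).
Proof.
apply/sigma_continuousP => -[phi Aphi] /=.
exact: (weak_star_alg_continuous (predual_lact b Aphi)).
Qed.

(* The element of [A] representing a bounded functional on the predual. *)
Definition predual_inv (Ast : predual) (F : dual (subsp Ast)) : A :=
  projT1 (cid (predual_surj F)).

Lemma predual_invK (Ast : predual) (F : dual (subsp Ast)) (phi : subsp Ast) :
  dual_fun (val phi) (predual_inv F) = F phi.
Proof. by rewrite /predual_inv; case: cid => a /= <-. Qed.

Section SigmaWC.
Variables (Ast : predual) (X : normedModType C) (M : bimodule A X).

Definition sigmaWC : {pred X} := fun x =>
  `[< continuous ((lact M) ^~ x : weak_star_alg Ast -> weak_topology X) /\
      continuous (ract M x : weak_star_alg Ast -> weak_topology X) >].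

Lemma sigmaWC_submod_closed : submod_closed sigmaWC.
Proof.
have [_ Ml _] := lact_bounded M; have [Mr _ _] := ract_bounded M.
have Mr' a : linear ((ract M) ^~ a) by case: (ract_bounded M).
have Ml' a : linear (lact M a) by case: (lact_bounded M).
split.
  apply/asboolP; split; apply/sigma_continuousP => phi.
    rewrite (_ : (fun _ => _) = cst (phi 0)); first exact: cst_continuous.
    by apply/funext => a; rewrite (linear_0 (Ml' a)).
  rewrite (_ : (fun _ => _) = cst (phi 0)); first exact: cst_continuous.
  by apply/funext => a; rewrite (linear_0 (Mr' a)).
move=> c x y /asboolP[/sigma_continuousP lx /sigma_continuousP rx].
move=> /asboolP[/sigma_continuousP ly /sigma_continuousP ry].
apply/asboolP; split; apply/sigma_continuousP => phi.
  rewrite (_ : (fun _ => _) =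
      fun a => c *: (phi (lact M a x) : C^o) + phi (lact M a y)).
    exact: (continuous_comb (lx phi) (ly phi)).
  by apply/funext => b; rewrite Ml' (dual_linear phi).
rewrite (_ : (fun _ => _) =
    fun a => c *: (phi (ract M x a) : C^o) + phi (ract M y a)).
  exact: (continuous_comb (rx phi) (ry phi)).
by apply/funext => b; rewrite Mr' (dual_linear phi).
Qed.

HB.instance Definition _ :=
  GRing.isSubmodClosed.Build C X sigmaWC sigmaWC_submod_closed.

Lemma sigmaWC_lact a x : x \in sigmaWC -> lact M a x \in sigmaWC.
Proof.
move=> /asboolP[/sigma_continuousP lx /sigma_continuousP rx].
apply/asboolP; split; apply/sigma_continuousP => phi.
  rewrite (_ : (fun _ => _) = (fun b => phi (lact M b x)) \o bmul ^~ a).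
    by move=> b; exact: (continuous_comp (@bmulr_weak_star Ast a b) (@lx phi _)).
  by apply/funext => b /=; rewrite lactA.
rewrite (_ : (fun _ => _) =
    (fun b => adjoint (bounded_bilinearr a (lact_bounded M)) phi (ract M x b))).
  exact: rx.
by apply/funext => b /=; rewrite lract.
Qed.

Lemma sigmaWC_ract x a : x \in sigmaWC -> ract M x a \in sigmaWC.
Proof.
move=> /asboolP[/sigma_continuousP lx /sigma_continuousP rx].
apply/asboolP; split; apply/sigma_continuousP => phi.
  rewrite (_ : (fun _ => _) =
      (fun b => adjoint (bounded_bilinearl a (ract_bounded M)) phi (lact M b x))).
    exact: lx.
  by apply/funext => b /=; rewrite -lract.
rewrite (_ : (fun _ => _) = (fun b => phi (ract M x b)) \o bmul a).
  by move=> b; exact: (continuous_comp (@bmull_weak_star Ast a b) (@rx phi _)).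
by apply/funext => b /=; rewrite ractA.
Qed.

Definition sigmaWC_bimodule : bimodule A (subsp sigmaWC) :=
  sub_bimodule sigmaWC_lact sigmaWC_ract.

End SigmaWC.

Definition derivation (X : normedModType C) (M : bimodule A X) (D : A -> X) :=
  bounded_linear D /\
  forall a b, D (bmul a b) = lact M a (D b) + ract M (D a) b.

Definition approximately_inner (X : normedModType C) (M : bimodule A X)
    (D : A -> X) : Prop :=
  exists x : net X,
    forall a, lact M a (x i) - ract M (x i) a @[i --> tails x] --> D a.

Definition normal_dual_bimodule (Ast : predual) (Y : normedModType C)
    (M : bimodule A Y) : Prop :=
  forall x : dual Y,
    continuous ((lact (dual_bimodule M)) ^~ x :
      weak_star_alg Ast -> weak_star_topology Y) /\
    continuous (ract (dual_bimodule M) x :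
      weak_star_alg Ast -> weak_star_topology Y).

Definition approximately_Connes_amenable (Ast : predual) : Prop :=
  forall (Y : completeNormedModType C) (M : bimodule A Y),
    normal_dual_bimodule Ast M ->
  forall D : A -> dual Y, derivation (dual_bimodule M) D ->
    continuous (D : weak_star_alg Ast -> weak_star_topology Y) ->
    approximately_inner (dual_bimodule M) D.

End DualBanachAlgebra.

Section ProjectiveTensor.
Context {R : realType}.
Local Notation C := R[i].

Definition bilinear_sum (V W : Type) (Z : nmodType) (B : V -> W -> Z)
    (s : seq (V * W)) : Z := \sum_(p <- s) B p.1 p.2.

Section Def.
Variables (V W : normedModType C).

Definition bilinear_map (Z : lmodType C) (B : V -> W -> Z) : Prop :=
  (forall x, linear (B x)) /\ (forall y, linear (B ^~ y)).

(* A completion of the algebraic tensor product for the projective norm,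
   determined up to isometric isomorphism: [tens_algebraic] says that the span of
   the elementary tensors is the algebraic tensor product, and [tens_norm] that
   its norm is the infimum of [sum |x_i| |y_i|] over all representations. *)
Record projective_tensor := ProjectiveTensor {
  pt_space :> completeNormedModType C;
  tens : V -> W -> pt_space;
  tens_bilinear : bilinear_map tens;
  tens_algebraic : forall s, bilinear_sum tens s = 0 ->
    forall (Z : lmodType C) (B : V -> W -> Z),
      bilinear_map B -> bilinear_sum B s = 0;
  tens_norm : forall s, rnorm (bilinear_sum tens s) =
    inf [set \sum_(p <- t) rnorm p.1 * rnorm p.2 |
         t in [set t | bilinear_sum tens t = bilinear_sum tens s]];
  tens_dense : dense (range (bilinear_sum tens))
}.

End Def.

Section Lift.
Variables (V W : normedModType C) (T : projective_tensor V W).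
Variable Z : completeNormedModType C.

Definition scale_seq (a : C) (s : seq (V * W)) := [seq (a *: p.1, p.2) | p <- s].

Lemma bsumZ (Y : lmodType C) (B : V -> W -> Y) a s : bilinear_map B ->
  bilinear_sum B (scale_seq a s) = a *: bilinear_sum B s.
Proof.
move=> [_ Bl]; rewrite /bilinear_sum big_map scaler_sumr.
by apply: eq_bigr => p _ /=; rewrite (linear_Z (Bl p.2)).
Qed.

Lemma bsum_cat (Y : lmodType C) (B : V -> W -> Y) s t :
  bilinear_sum B (s ++ t) = bilinear_sum B s + bilinear_sum B t.
Proof. exact: big_cat. Qed.

Lemma bsum_comb (Y : lmodType C) (B : V -> W -> Y) a s t : bilinear_map B ->
  bilinear_sum B (scale_seq a s ++ t) = a *: bilinear_sum B s + bilinear_sum B t.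
Proof. by move=> BB; rewrite bsum_cat bsumZ. Qed.

Lemma bsumB (Y : lmodType C) (B : V -> W -> Y) s t : bilinear_map B ->
  bilinear_sum B (scale_seq (- 1) t ++ s) = bilinear_sum B s - bilinear_sum B t.
Proof. by move=> BB; rewrite bsum_comb // scaleN1r addrC. Qed.

Lemma RCM (x y : R) : (x * y)%:C = x%:C * y%:C.
Proof. exact: rmorphM. Qed.

Lemma RCsum (I : Type) (r : seq I) (F : I -> R) :
  (\sum_(i <- r) F i)%:C = \sum_(i <- r) (F i)%:C.
Proof. exact: rmorph_sum. Qed.

Local Notation tsum := (bilinear_sum (tens T)).
#[local] Hint Resolve tens_bilinear : core.

Lemma tens_le x y : `|tens T x y| <= `|x| * `|y|.
Proof.
rewrite -!rnormE -RCM lecR.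
have -> : tens T x y = tsum [:: (x, y)] by rewrite /bilinear_sum big_seq1.
rewrite tens_norm; apply: ge_inf.
  exists 0 => _ [t _ <-]; apply: sumr_ge0 => p _.
  by rewrite mulr_ge0 ?rnorm_ge0.
by exists [:: (x, y)] => //; rewrite big_seq1.
Qed.

Section Bounded.
Variables (B : V -> W -> Z) (k : R).
Hypothesis BB : bilinear_map B.
Hypothesis k0 : 0 <= k.
Hypothesis Bk : forall x y, `|B x y| <= k%:C * `|x| * `|y|.

Local Notation bsum := (bilinear_sum B).

Lemma bsum_eq s t : tsum s = tsum t -> bsum s = bsum t.
Proof.
move=> st; apply/eqP; rewrite -subr_eq0 -bsumB //; apply/eqP.
apply: (@tens_algebraic _ _ T) BB; rewrite bsumB //.
by apply/eqP; rewrite subr_eq0; apply/eqP.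
Qed.

Lemma bsum_le s : `|bsum s| <= k%:C * `|tsum s|.
Proof.
have le t : tsum t = tsum s ->
    rnorm (bsum s) <= k * \sum_(p <- t) rnorm p.1 * rnorm p.2.
  move=> /bsum_eq <-; rewrite -lecR rnormE RCM RCsum mulr_sumr.
  apply: (le_trans (ler_norm_sum _ _ _)); apply: ler_sum => p _.
  by rewrite RCM !rnormE mulrA.
rewrite -!rnormE -RCM lecR tens_norm.
move: k0; rewrite le_eqVlt => /predU1P[k_eq0|kp].
  by rewrite -k_eq0 mul0r; have := le s erefl; rewrite -k_eq0 mul0r.
rewrite mulrC -ler_pdivrMr //; apply: lb_le_inf.
  by exists (\sum_(p <- s) rnorm p.1 * rnorm p.2), s.
by move=> _ [t /= ts <-]; rewrite ler_pdivrMr // mulrC; exact: le.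
Qed.

Lemma tens_approx u e : 0 < e -> exists s, `|u - tsum s| < e.
Proof.
move=> e0; have [v [uv [s _ sv]]] : ball u e `&` range tsum !=set0.
  by apply: tens_dense; [exists u; exact: ballxx | exact: ball_open].
by exists s; rewrite sv; move: uv; rewrite -ball_normE.
Qed.

Definition lift_graph (u : T) (z : Z) := forall e : C, 0 < e ->
  exists s, `|u - tsum s| < e /\ `|z - bsum s| < e.

Lemma lift_graph_le u z : lift_graph u z -> `|z| <= k%:C * `|u|.
Proof.
move=> g; apply/ler_addgt0Pr => e e0.
have k10 : 0 < 1 + k%:C by rewrite ltr_pwDl // lecR.
have [s [us zs]] := g (e / (1 + k%:C)) (divr_gt0 e0 k10).
rewrite -[z](subrK (bsum s)).
apply: (le_trans (ler_normD _ _)).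
have ts : `|tsum s| <= `|u| + e / (1 + k%:C).
  rewrite -[tsum s](subrK u) addrC (le_trans (ler_normD _ _)) // lerD2l.
  by rewrite distrC ltW.
apply: (le_trans (lerD (ltW zs) (bsum_le s))).
apply: (le_trans (lerD (lexx _) (ler_wpM2l _ ts))); first by rewrite lecR.
rewrite mulrDr addrCA lerD2l -[X in X + _]mul1r -mulrDl mulrCA divff ?mulr1 //.
by rewrite gt_eqF.
Qed.

Lemma lift_graph_comb a u v z w : lift_graph u z -> lift_graph v w ->
  lift_graph (a *: u + v) (a *: z + w).
Proof.
move=> gu gv e e0.
have a10 : 0 < `|a| + 1 by rewrite ltr_pwDr.
have e' : 0 < e / (`|a| + 1) by rewrite divr_gt0.
have [s [us zs]] := gu _ e'; have [t [vt wt]] := gv _ e'.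
have aux (Y : normedModType C) (x x' y y' : Y) :
    `|x - x'| < e / (`|a| + 1) -> `|y - y'| < e / (`|a| + 1) ->
    `|a *: x + y - (a *: x' + y')| < e.
  move=> xx yy; rewrite opprD addrACA -scalerBr.
  apply: (le_lt_trans (ler_normD _ _)); rewrite normrZ.
  apply: (le_lt_trans (lerD (ler_wpM2l (normr_ge0 _) (ltW xx)) (lexx _))).
  have eE : e = `|a| * (e / (`|a| + 1)) + e / (`|a| + 1).
    by rewrite -[X in _ + X]mul1r -mulrDl mulrCA divff ?mulr1 // gt_eqF.
  by rewrite [ltRHS]eE ltrD2l.
exists (scale_seq a s ++ t); rewrite !bsum_comb //.
by split; apply: aux.
Qed.

Lemma lift_graph_ex u : exists z, lift_graph u z.
Proof.
pose F : set_system Z := filter_from [set e : C | 0 < e]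
  (fun e => bsum @` [set s | `|u - tsum s| < e]).
have FF : ProperFilter F.
  apply: filter_from_proper => [|e /= e0]; last 1 first.
    by have [s us] := tens_approx u e0; exists (bsum s), s.
  apply: filter_from_filter; first by exists 1; exact: ltr01.
  move=> e f /= e0 f0; exists (Order.min e f).
    by rewrite /= /Order.min; case: ifP.
  have ef : (Order.min e f <= e) && (Order.min e f <= f).
    rewrite /Order.min; case: (real_ltP (gtr0_real e0) (gtr0_real f0)).
      by move=> /ltW ->; rewrite lexx.
    by move=> ->; rewrite lexx.
  move: ef => /andP[mine minf] _ [s /= us <-].
  by split; exists s => //=; exact: lt_le_trans us _.
have Fc : cauchy F.
  apply: cauchy_exP => e e0.
  have k10 : 0 < 1 + k%:C by rewrite ltr_pwDl // lecR.
  have d0 : 0 < e / (1 + k%:C) / 2 by rewrite divr_gt0 ?divr_gt0.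
  have [s us] := tens_approx u d0; exists (bsum s), (e / (1 + k%:C) / 2) => //.
  move=> _ [t /= ut <-]; rewrite -ball_normE /=.
  rewrite -bsumB //.
  apply: (le_lt_trans (bsum_le _)); rewrite bsumB //.
  have st : `|tsum s - tsum t| < e / (1 + k%:C).
    rewrite -[tsum s](subrK u) -addrA (splitr (e / _)).
    by apply: (le_lt_trans (ler_normD _ _)); apply: ltrD => //; rewrite distrC.
  rewrite (le_lt_trans (ler_wpM2l _ (ltW st))) ?lecR //.
  by rewrite mulrA ltr_pdivrMr // mulrC ltr_pM2l // ltr_pwDl // lexx.
have /cauchy_cvg Fl := Fc.
exists (lim F) => e e0.
have : F (ball (lim F) e) by apply: Fl; exact: nbhsx_ballx.
move=> [d /= d0 dF].
have m0 : 0 < Order.min e d by rewrite /Order.min; case: ifP.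
have ed : (Order.min e d <= e) && (Order.min e d <= d).
  rewrite /Order.min; case: (real_ltP (gtr0_real e0) (gtr0_real d0)).
    by move=> /ltW ->; rewrite lexx.
  by move=> ->; rewrite lexx.
move: ed => /andP[mine mind].
have [s us] := tens_approx u m0.
exists s; split; first exact: lt_le_trans us mine.
have : ball (lim F) e (bsum s) by apply: dF; exists s => //=; exact: lt_le_trans us mind.
by rewrite -ball_normE.
Qed.

Lemma tens_lift_ex : exists f : T -> Z,
  [/\ linear f, forall u, `|f u| <= k%:C * `|u| &
      forall x y, f (tens T x y) = B x y].
Proof.
pose f u := projT1 (cid (lift_graph_ex u)).
have fP u : lift_graph u (f u) by rewrite /f; case: cid.
have uniq u z z' : lift_graph u z -> lift_graph u z' -> z = z'.
  move=> g g'; have := lift_graph_le (lift_graph_comb (- 1) g' g).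
  rewrite !scaleN1r addNr normr0 mulr0 normr_le0 addrC subr_eq0.
  by move=> /eqP.
exists f; split=> [a u v|u|x y].
- apply: (uniq (a *: u + v)); first exact: fP.
  by apply: lift_graph_comb; exact: fP.
- by apply: lift_graph_le; exact: fP.
- apply: (uniq (tens T x y)); first exact: fP.
  move=> e e0; exists [:: (x, y)].
  by rewrite /bilinear_sum !big_seq1 !subrr !normr0.
Qed.

End Bounded.

Lemma tens_ext (f g : T -> Z) : bounded_linear f -> bounded_linear g ->
  (forall x y, f (tens T x y) = g (tens T x y)) -> f = g.
Proof.
move=> bf bg fg; apply/funext => u; apply/eqP; rewrite -subr_eq0 -normr_le0.
have [k k0 hk] := bounded_linear_real (bounded_linear_comb (- 1) bg bf).
have hl : linear ((- 1) *: g + f).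
  by case: (bounded_linear_comb (- 1) bg bf).
have h0 s : ((- 1) *: g + f) (tsum s) = 0.
  rewrite /bilinear_sum; elim: s => [|p s IH].
    by rewrite big_nil (linear_0 hl).
  rewrite big_cons (linear_D hl) IH addr0 !fctE fg.
  by rewrite scaleN1r addNr.
have hE : f u - g u = ((- 1) *: g + f) u by rewrite !fctE scaleN1r addrC.
apply/ler_addgt0Pr => e e0; rewrite add0r hE.
have k10 : 0 < 1 + k%:C by rewrite ltr_pwDl // lecR.
have d0 : 0 < e / (1 + k%:C) by rewrite divr_gt0.
have [v [uv [s _ sv]]] : ball u (e / (1 + k%:C)) `&` range tsum !=set0.
  by apply: tens_dense; [exists u; exact: ballxx | exact: ball_open].
move: uv; rewrite -ball_normE /= -sv => us.
rewrite -[u](subrK (tsum s)) (linear_D hl) h0 addr0.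
apply: (le_trans (hk _)).
apply: (le_trans (ler_wpM2l _ (ltW us))); first by rewrite lecR.
by rewrite mulrA ler_pdivrMr // mulrC ler_pM2l // lerDr.
Qed.

(* The bounded linear map induced by a bounded bilinear map; see [tens_liftP]. *)
Definition tens_lift (B : V -> W -> Z) : T -> Z :=
  xget (fun=> 0) [set f | bounded_linear f /\
                          forall x y, f (tens T x y) = B x y].

Lemma tens_liftP (B : V -> W -> Z) (k : R) : bilinear_map B -> 0 <= k ->
    (forall x y, `|B x y| <= k%:C * `|x| * `|y|) ->
  [/\ bounded_linear (tens_lift B), forall u, `|tens_lift B u| <= k%:C * `|u| &
      forall x y, tens_lift B (tens T x y) = B x y].
Proof.
move=> BB k0 Bk; have [f [fl fk fB]] := tens_lift_ex BB k0 Bk.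
have bf : bounded_linear f by split=> //; exists k%:C.
suff -> : tens_lift B = f by [].
apply: xget_unique => // g [bg gB].
by apply: tens_ext => // x y; rewrite gB fB.
Qed.

End Lift.

End ProjectiveTensor.

Section TensorBimodule.
Context {R : realType}.
Local Notation C := R[i].
Variables (A : banachAlgType R) (T : projective_tensor A A).

Definition tens_actl (a b c : A) : T := tens T (bmul a b) c.
Definition tens_actr (a b c : A) : T := tens T b (bmul c a).

Definition tens_lact (a : A) : T -> T := tens_lift (tens_actl a).
Definition tens_ract (u : T) (a : A) : T := tens_lift (tens_actr a) u.

Lemma tens_lactP a :
  [/\ bounded_linear (tens_lact a), forall u, `|tens_lact a u| <= `|a| * `|u| &
      forall b c, tens_lact a (tens T b c) = tens T (bmul a b) c].
Proof.
rewrite -(rnormE a); apply: tens_liftP => [||b c].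
- have [Tl Tr] := tens_bilinear T; split=> [b|c x b b']; first exact: Tl.
  by rewrite /tens_actl bmul_linearr; exact: Tr.
- exact: rnorm_ge0.
- by rewrite rnormE (le_trans (tens_le _ _ _)) // ler_wpM2r // normr_bmul.
Qed.

Lemma tens_ractP a :
  [/\ bounded_linear (tens_ract ^~ a), forall u, `|tens_ract u a| <= `|a| * `|u| &
      forall b c, tens_ract (tens T b c) a = tens T b (bmul c a)].
Proof.
rewrite -(rnormE a); apply: tens_liftP => [||b c].
- have [Tl Tr] := tens_bilinear T; split=> [b x c c'|c]; last exact: Tr.
  by rewrite /tens_actr bmul_linearl; exact: Tl.
- exact: rnorm_ge0.
- rewrite rnormE (le_trans (tens_le _ _ _)) //.
  have -> : `|a| * `|b| * `|c| = `|b| * (`|c| * `|a|).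
    by rewrite [RHS]mulrA [RHS]mulrC -[LHS]mulrA.
  by rewrite ler_wpM2l // normr_bmul.
Qed.

Lemma tens_lact_bounded : bounded_bilinear tens_lact.
Proof.
split=> [a|u c a a'|].
- by have [[]] := tens_lactP a.
- have [b1 _ e1] := tens_lactP (c *: a + a').
  have [b2 _ e2] := tens_lactP a; have [b3 _ e3] := tens_lactP a'.
  have -> // : tens_lact (c *: a + a') = c *: tens_lact a + tens_lact a'.
  apply: tens_ext => //; first exact: bounded_linear_comb.
  move=> x y; rewrite e1 !fctE e2 e3 bmul_linearl.
  by have [_ Tr] := tens_bilinear T; exact: Tr.
- by exists 1 => a u; rewrite mul1r; have [_ + _] := tens_lactP a; exact.
Qed.

Lemma tens_ract_bounded : bounded_bilinear tens_ract.
Proof.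
split=> [u c a a'|a|].
- have [b1 _ e1] := tens_ractP (c *: a + a').
  have [b2 _ e2] := tens_ractP a; have [b3 _ e3] := tens_ractP a'.
  suff /(congr1 (fun f => f u)) : tens_ract ^~ (c *: a + a') =
      c *: tens_ract ^~ a + tens_ract ^~ a' by [].
  apply: tens_ext => //; first exact: bounded_linear_comb.
  move=> x y; rewrite e1 !fctE e2 e3 bmul_linearr.
  by have [Tl _] := tens_bilinear T; exact: Tl.
- by have [[]] := tens_ractP a.
- exists 1 => u a; rewrite mul1r mulrC.
  by have [_ + _] := tens_ractP a; exact.
Qed.

Lemma tens_lactA a b u : tens_lact (bmul a b) u = tens_lact a (tens_lact b u).
Proof.
have [b1 _ e1] := tens_lactP (bmul a b).
have [b2 _ e2] := tens_lactP a; have [b3 _ e3] := tens_lactP b.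
suff -> : tens_lact (bmul a b) = tens_lact a \o tens_lact b by [].
apply: tens_ext => [//||x y]; first exact: bounded_linear_comp.
by rewrite e1 /= e3 e2 bmulA.
Qed.

Lemma tens_ractA u a b : tens_ract u (bmul a b) = tens_ract (tens_ract u a) b.
Proof.
have [b1 _ e1] := tens_ractP (bmul a b).
have [b2 _ e2] := tens_ractP a; have [b3 _ e3] := tens_ractP b.
suff -> : tens_ract u (bmul a b) = (tens_ract ^~ b \o tens_ract ^~ a) u by [].
congr (_ u); apply: (@tens_ext _ _ _ T T (tens_ract ^~ (bmul a b))) => [//||x y].
  exact: bounded_linear_comp.
by rewrite e1 /= e2 e3 bmulA.
Qed.

Lemma tens_lract a u b : tens_ract (tens_lact a u) b = tens_lact a (tens_ract u b).
Proof.
have [b2 _ e2] := tens_lactP a; have [b3 _ e3] := tens_ractP b.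
suff /(congr1 (fun f => f u)) :
  tens_ract ^~ b \o tens_lact a = tens_lact a \o tens_ract ^~ b by [].
apply: tens_ext => [||x y]; try exact: bounded_linear_comp.
by rewrite /= e2 !e3 e2.
Qed.

Definition tens_bimodule : bimodule A T :=
  Bimodule tens_lact_bounded tens_ract_bounded tens_lactA tens_ractA tens_lract.

Definition Delta : T -> A := tens_lift (bmul : A -> A -> A).

Lemma DeltaP : [/\ bounded_linear Delta, forall u, `|Delta u| <= `|u| &
  forall a b, Delta (tens T a b) = bmul a b].
Proof.
have Bb : bilinear_map (bmul : A -> A -> A).
  by split; [exact: bmul_linearr | exact: bmul_linearl].
have Bk (a b : A) : `|bmul a b| <= 1%:C * `|a| * `|b|.
  by rewrite mul1r normr_bmul.
have [bD Dle De] := tens_liftP T Bb ler01 Bk.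
by split=> // u; have := Dle u; rewrite mul1r.
Qed.

Lemma Delta_bounded : bounded_linear Delta.
Proof. by case: DeltaP. Qed.

Lemma Delta_lact a u : Delta (tens_lact a u) = bmul a (Delta u).
Proof.
have [bD _ De] := DeltaP; have [b2 _ e2] := tens_lactP a.
suff /(congr1 (fun f => f u)) : Delta \o tens_lact a = bmul a \o Delta by [].
apply: tens_ext => [||x y]; first exact: bounded_linear_comp.
  by apply: bounded_linear_comp => //; exact: (bounded_bilinearr _ (bmul_bounded A)).
by rewrite /= e2 !De bmulA.
Qed.

Lemma Delta_ract u a : Delta (tens_ract u a) = bmul (Delta u) a.
Proof.
have [bD _ De] := DeltaP; have [b2 _ e2] := tens_ractP a.
suff /(congr1 (fun f => f u)) : Delta \o tens_ract ^~ a = bmul ^~ a \o Delta by [].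
apply: tens_ext => [||x y]; first exact: bounded_linear_comp.
  by apply: bounded_linear_comp => //; exact: (bounded_bilinearl _ (bmul_bounded A)).
by rewrite /= e2 !De bmulA.
Qed.

Variable Ast : predual A.

Local Notation WC := (sigmaWC Ast (dual_bimodule tens_bimodule)).

Lemma Delta_adj_bounded :
  bounded_linear (fun phi : subsp Ast => adjoint Delta_bounded (val phi)).
Proof.
exact: bounded_linear_comp (adjoint_bounded Delta_bounded) (subsp_val_bounded _).
Qed.

Lemma adjoint_Delta_sigmaWC (phi : dual A) : phi \in Ast ->
  adjoint Delta_bounded phi \in WC.
Proof.
move=> Aphi; apply/asboolP; split; apply/sigma_continuousP => psi.
- pose F := mk_dual (bounded_linear_comp (dual_bounded psi) Delta_adj_bounded).
  pose b : A := predual_inv F.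
  rewrite (_ : (fun _ => _) =
      dual_fun (ract (dual_bimodule (regular_bimodule A)) phi b)).
    exact: weak_star_alg_continuous (predual_ract b Aphi).
  apply/funext => a.
  refine (etrans _ (esym (predual_invK F (mk_subsp (predual_lact a Aphi))))).
  rewrite /F /=.
  congr (dual_fun psi _); apply: dual_ext => u.
  exact: (congr1 (dual_fun phi) (Delta_ract u a)).
- pose F := mk_dual (bounded_linear_comp (dual_bounded psi) Delta_adj_bounded).
  pose b : A := predual_inv F.
  rewrite (_ : (fun _ => _) =
      dual_fun (lact (dual_bimodule (regular_bimodule A)) b phi)).
    exact: weak_star_alg_continuous (predual_lact b Aphi).
  apply/funext => a.
  refine (etrans _ (esym (predual_invK F (mk_subsp (predual_ract a Aphi))))).
  rewrite /F /=.
  congr (dual_fun psi _); apply: dual_ext => u.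
  exact: (congr1 (dual_fun phi) (Delta_lact a u)).
Qed.

(* The functional sending [phi] to the pairing of [M] with the adjoint of [Delta]
   at [phi]. *)
Definition Delta_sigmaWC_fun (M : dual (subsp WC)) (phi : subsp Ast) : C^o :=
  M (mk_subsp (adjoint_Delta_sigmaWC (valP phi))).

Lemma Delta_sigmaWC_fun_bounded (M : dual (subsp WC)) :
  bounded_linear (Delta_sigmaWC_fun M).
Proof.
split.
  move=> a phi psi; rewrite /Delta_sigmaWC_fun -(dual_linear M).
  congr (dual_fun M _); apply: mk_subsp_comb.
  by rewrite subsp_comb adjoint_linear.
exists (opnorm M) => phi; apply: (le_trans (opnorm_ub M _)).
apply: ler_wpM2l; first exact: opnorm_ge0.
rewrite -[leRHS]mul1r; apply: adjoint_le => // u.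
by have [_ + _] := DeltaP; rewrite mul1r; exact.
Qed.

Definition Delta_sigmaWC (M : dual (subsp WC)) : A :=
  predual_inv (mk_dual (Delta_sigmaWC_fun_bounded M)).

Lemma Delta_sigmaWCE (M : dual (subsp WC)) (phi : subsp Ast) :
  dual_fun (val phi) (Delta_sigmaWC M) =
  M (mk_subsp (adjoint_Delta_sigmaWC (valP phi))).
Proof. exact: predual_invK. Qed.

Definition approximate_sigmaWC_virtual_diagonal (e : A)
    (M : net (dual (subsp WC))) : Prop :=
  let N := dual_bimodule (sigmaWC_bimodule Ast (dual_bimodule tens_bimodule)) in
  (forall a, lact N a (M i) - ract N (M i) a @[i --> tails M] --> 0) /\
  Delta_sigmaWC (M i) @[i --> tails M] --> e.

End TensorBimodule.

(* Main.v *)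
Require Import Defs.
From HB Require Import structures.
From mathcomp Require Import all_boot all_order all_algebra.
From mathcomp Require Import all_classical all_reals all_analysis.
From mathcomp.real_closed Require Import complex.
From mathcomp Require Import ring lra.

(** Why the equivalence holds.  Write [E] for the elementary tensor [e (x) e] and
    [WC] for the sigma-WC part of the dual of the projective tensor square.

    From a virtual diagonal to inner nets.  If [m] were an invariant diagonal,
    formally [m = sum b (x) c] with [sum b c = e], then averaging a derivation [D]
    to [x = sum b . D c] gives [a . x - x . a = e . D a], because
    [c . D a = D (c a) - D c . a] telescopes against the invariance of [m].  In
    rigorous terms [x] is the functional [y |-> m (G y)], where [G y] sends
    [b (x) c] to [(b . D c) y]; the weak-star continuity of [D] and the normality
    of the module are exactly what puts [G y] in [WC] ([forms_sigmaWC]), so that [m]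
    may be applied.  For an arbitrary [m] the two defects, [a . m - m . a] and the
    distance from [Delta m] to [e], enter additively ([averaged_derivation]) and
    tend to zero along the net.  As the module need not be unital, [e . D a]
    differs from [D a]; the difference is an inner derivation ([derivation_unit]).

    From amenability to a virtual diagonal.  [Delta] maps evaluation at [E] to
    [e], but the evaluation is not invariant; its defect [a . E - E . a] is a
    derivation with values in the kernel of [Delta].  If that derivation is
    approximately inner with implementing elements in the kernel, subtracting them
    from [E] gives the diagonal.  The kernel is the dual of the quotient of [WC] by
    the range [J] of the adjoint of [Delta] on the predual.  Instead of a quotient,
    the proof uses that [J] is complemented: since [A] has an identity,
    [F |-> F (. (x) e)] splits the adjoint of [Delta], whence an idempotent
    [deflate] of [WC] with kernel [J].  It commutes with the right action but not
    with the left one; composing the left action with it turns [WC] into another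
    Banach bimodule ([twisted_bimodule]) to which amenability is applied, and the
    adjoint of [deflate] carries the resulting net into the kernel of [Delta]
    ([twisted_correction_cvg]).

    Functional analysis used on the way: a weak-star continuous functional on [A]
    is an element of the predual ([predualP]), so membership in [WC] can be tested
    on coefficient functionals ([sigmaWCP]) and [WC] is norm closed, hence complete;
    and the Hahn-Banach theorem, which makes [WC], as a bimodule of its own, equal to
    its own sigma-WC part ([sigmaWC_sigmaWC]), that is, makes its dual normal. *)

Set Implicit Arguments.
Unset Strict Implicit.
Unset Printing Implicit Defensive.

Import Order.TTheory GRing.Theory Num.Theory.
Import numFieldNormedType.Exports.

Local Open Scope classical_set_scope.
Local Open Scope ring_scope.
Local Open Scope complex_scope.

(** * The Hahn-Banach theorem *)

Section RealHahnBanach.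
Context {R : realType}.
Local Notation C := R[i].
Variables (V : lmodType C) (p : V -> R).
Hypothesis p_subadd : forall x y, p (x + y) <= p x + p y.
Hypothesis p_homog : forall (t : R) x, 0 < t -> p (t%:C *: x) = t * p x.

(** Partial real-linear functionals are handled as graphs, so that unions of chains
    need no gluing.  Single-valuedness is not part of the definition: it follows
    from domination ([dominated_graph_functional]). *)
Definition dominated_graph (G : set (V * R)) :=
  [/\ forall u w, G u -> G w -> G (u.1 + w.1, u.2 + w.2),
      forall (t : R) u, G u -> G (t%:C *: u.1, t * u.2) &
      forall u, G u -> u.2 <= p u.1].

Definition graph_adjoin (G : set (V * R)) (v : V) (c : R) : set (V * R) :=
  [set w | exists u (t : R), G u /\ w = (u.1 + t%:C *: v, u.2 + t * c)].

(** The one-dimensional extension step: subadditivity makes every lower constraint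
    on the value at [v] at most every upper one, so their supremum is admissible. *)
Lemma dominated_graph_adjoin (G : set (V * R)) (v : V) :
  dominated_graph G -> G !=set0 ->
  exists c, dominated_graph (graph_adjoin G v c).
Proof.
move=> [GD GZ Gp] [u0 Gu0].
pose E := [set u.2 - p (u.1 - v) | u in G].
have sep u w : G u -> G w -> u.2 - p (u.1 - v) <= p (w.1 + v) - w.2.
  move=> Gu Gw; rewrite lerBlDr addrAC lerBrDr.
  apply: (le_trans (Gp _ (GD _ _ Gu Gw))) => /=.
  have -> : u.1 + w.1 = (u.1 - v) + (w.1 + v) by rewrite addrACA addNr addr0.
  by rewrite addrC p_subadd.
have Eub u : G u -> u.2 - p (u.1 - v) <= sup E.
  move=> Gu; apply: ub_le_sup; last by exists u.
  by exists (p (u0.1 + v) - u0.2) => _ [w Gw <-]; exact: sep.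
have Elb w : G w -> sup E <= p (w.1 + v) - w.2.
  move=> Gw; apply: ge_sup; first by exists (u0.2 - p (u0.1 - v)), u0.
  by move=> _ [u Gu <-]; exact: sep.
exists (sup E); split.
- move=> _ _ [u [t [Gu ->]]] [w [s [Gw ->]]] /=.
  exists (u.1 + w.1, u.2 + w.2), (t + s); split; first exact: GD.
  by rewrite /= rmorphD scalerDl mulrDl; congr pair; rewrite addrACA.
- move=> s _ [u [t [Gu ->]]] /=.
  exists (s%:C *: u.1, s * u.2), (s * t); split; first exact: GZ.
  by rewrite /= scalerDr scalerA -rmorphM mulrDr mulrA.
- move=> _ [u [t [Gu ->]]] /=.
  have [t0|t0|->] := ltgtP t 0; last first.
  + by rewrite scale0r mul0r !addr0; exact: Gp.
  + have -> : u.1 + t%:C *: v = t%:C *: (t^-1%:C *: u.1 + v).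
      by rewrite scalerDr scalerA -rmorphM divff ?gt_eqF // scale1r.
    have := Elb _ (GZ t^-1 _ Gu); rewrite p_homog //= -(ler_pM2l t0).
    by rewrite mulrBr mulVKf ?gt_eqF // => ?; lra.
  + have s0 : 0 < - t by rewrite oppr_gt0.
    have -> : u.1 + t%:C *: v = (- t)%:C *: ((- t)^-1%:C *: u.1 - v).
      rewrite scalerBr scalerA -rmorphM divff ?gt_eqF // scale1r.
      by rewrite rmorphN scaleNr opprK.
    have := Eub _ (GZ (- t)^-1 _ Gu); rewrite p_homog //= -(ler_pM2l s0).
    by rewrite mulrBr mulVKf ?gt_eqF // => ?; lra.
Qed.

(** The difference of two values at the same point is a value at [0], where [p]
    vanishes, and so is its opposite. *)
Lemma dominated_graph_functional (G : set (V * R)) x s t :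
  dominated_graph G -> G (x, s) -> G (x, t) -> s = t.
Proof.
move=> [GD GZ Gp].
have p0 : p 0 = 0.
  have := @p_homog 2%:R 0; rewrite scaler0 => /(_ (ltr0n _ 2)); lra.
suff le a b : G (x, a) -> G (x, b) -> a <= b.
  by move=> Gs Gt; apply/le_anti; rewrite !le.
move=> Ga Gb; have := Gp _ (GD _ _ Ga (GZ (-1) _ Gb)).
by rewrite /= rmorphN scaleN1r subrr p0 mulN1r subr_le0.
Qed.

(** A maximal dominated graph is defined everywhere, since it could otherwise be
    adjoined one more point. *)
Theorem real_hahn_banach (G0 : set (V * R)) :
  dominated_graph G0 -> G0 !=set0 ->
  exists g : V -> R, [/\ {morph g : x y / x + y},
    forall (t : R) x, g (t%:C *: x) = t * g x,
    forall x, g x <= p x & forall u, G0 u -> g u.1 = u.2].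
Proof.
move=> dG0 [u0 G0u0].
(* The implication lets the empty graph, the union of the empty chain, satisfy [P]. *)
pose P (G : set (V * R)) := dominated_graph G /\ (G !=set0 -> G0 `<=` G).
have [F FP Ftot|G [[dG G0G] Gmax]] := @Zorn_bigcup (V * R)%type P.
  split; last first.
    move=> [u [G FG Gu]] w G0w; exists G => //.
    by have [_] := FP _ FG; apply=> //; exists u.
  split.
  - move=> u w [G FG Gu] [H FH Hw].
    have [GH|HG] := Ftot _ _ FG FH.
      by exists H => //; have [[HD _ _] _] := FP _ FH; apply: HD => //; exact: GH.
    by exists G => //; have [[GD _ _] _] := FP _ FG; apply: GD => //; exact: HG.
  - move=> t u [G FG Gu]; exists G => //.
    by have [[_ GZ _] _] := FP _ FG; exact: GZ.
  - by move=> u [G FG Gu]; have [[_ _ Gp] _] := FP _ FG; exact: Gp.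
have Gu0 : G u0.
  apply: contrapT => nGu0.
  have G0' : G = set0.
    apply/seteqP; split=> // u Gu; apply: nGu0.
    by apply: G0G => //; exists u.
  apply: (Gmax G0); last by split=> // _ u Gu.
  by rewrite G0'; split=> // /(_ _ G0u0).
have {}G0G : G0 `<=` G by apply: G0G; exists u0.
have G00 : G (0, 0).
  by have [_ GZ _] := dG; have := GZ 0 _ Gu0; rewrite scale0r mul0r.
have Gtot x : exists t, G (x, t).
  have [c dGc] := dominated_graph_adjoin x dG (ex_intro _ _ Gu0).
  have GGc : G `<=` graph_adjoin G x c.
    by move=> [y s] Gy; exists (y, s), 0; rewrite scale0r mul0r !addr0.
  have Gcx : graph_adjoin G x c (x, c).
    by exists (0, 0), 1; rewrite scale1r mul1r !add0r.
  exists c; apply: contrapT => nGx; apply: (Gmax (graph_adjoin G x c)).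
    by split=> // /(_ _ Gcx).
  by split=> // _; exact: subset_trans GGc.
have [g gG] := choice Gtot.
have gE x t : G (x, t) -> g x = t.
  by move=> Gx; apply: (dominated_graph_functional dG (gG x) Gx).
have [GD GZ Gp] := dG.
exists g; split.
- by move=> x y; apply: gE; exact: GD (gG x) (gG y).
- by move=> t x; apply: gE; exact: GZ (gG x).
- by move=> x; exact: Gp (gG x).
- by move=> [x t] /G0G/gE.
Qed.

End RealHahnBanach.

Lemma normc_real (R : realType) (t : R) : `|t%:C| = `|t|%:C.
Proof. by rewrite normc_def /= expr0n addr0 sqrtr_sqr. Qed.

Section HahnBanach.
Context {R : realType}.
Local Notation C := R[i].
Variable V : normedModType C.

Lemma rnormD (x y : V) : rnorm (x + y) <= rnorm x + rnorm y.
Proof. by rewrite -lecR rmorphD /= !rnormE ler_normD. Qed.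

Lemma rnormZ (a : C) (x : V) : rnorm (a *: x) = rnorm (a : C^o) * rnorm x.
Proof. by apply: complexI; rewrite rmorphM /= !rnormE normrZ. Qed.

Lemma Re_le_rnorm (z : C) : complex.Re z <= rnorm (z : C^o).
Proof.
rewrite (le_trans (ler_norm _)) // -lecR rnormE.
exact: normc_ge_Re.
Qed.

(** A complex-linear functional is determined by its real part [g] as
    [x |-> g x - i g (i x)], so it suffices to extend the real part. *)
Theorem hahn_banach (S : submodClosed V) (f : dual (subsp S)) :
  exists F : dual V, forall y : subsp S, F (val y) = f y.
Proof.
have [k k0 fk] := bounded_linear_real (dual_bounded f).
pose p (x : V) := k * rnorm x.
have p_subadd x y : p (x + y) <= p x + p y.
  by rewrite /p -mulrDr ler_wpM2l // rnormD.
have p_homog (t : R) x : 0 < t -> p (t%:C *: x) = t * p x.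
  move=> t0; rewrite /p rnormZ; have -> : rnorm (t%:C : C^o) = t.
    by apply: complexI; rewrite rnormE ger0_norm // lecR ltW.
  by rewrite mulrCA.
pose G0 := [set u | exists y : subsp S, u = (val y, complex.Re (f y))].
have dG0 : dominated_graph p G0.
  split.
  - move=> _ _ [y ->] [z ->] /=; exists (y + z).
    by rewrite (linear_D (dual_linear f)); congr pair; rewrite raddfD.
  - move=> t _ [y ->] /=; exists (t%:C *: y).
    rewrite (linear_Z (dual_linear f)) [_ *: f y]/(_ * _); congr pair.
    by case: (dual_fun f y) => a b /=; rewrite mul0r subr0.
  - move=> _ [y ->] /=; apply: (le_trans (Re_le_rnorm _)).
    by rewrite -lecR rmorphM /= !rnormE; exact: fk.
have [|g [gD gZ gp gG]] := real_hahn_banach p_subadd p_homog dG0.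
  by exists (val (0 : subsp S), complex.Re (f 0)), 0.
pose i : C := 0 +i* 1.
pose F (x : V) : C^o := g x +i* (- g (i *: x)).
have gN x : `|g x| <= p x.
  rewrite ler_norml gp andbT lerNl.
  have <- : g (- x) = - g x.
    by have := gZ (-1) x; rewrite rmorphN scaleN1r mulN1r.
  apply: (le_trans (gp _)); rewrite /p ler_wpM2l //.
  by rewrite -lecR !rnormE normrN.
have gC a b x : g ((a +i* b) *: x) = a * g x + b * g (i *: x).
  have -> : a +i* b = a%:C + b%:C * i.
    by apply/eqP; rewrite /i eq_complex /=; apply/andP; split; apply/eqP; ring.
  by rewrite scalerDl -scalerA gD !gZ.
have Flin : linear F.
  move=> [a b] x y; rewrite /F scalerDr !gD (gC a b) scalerA.
  have -> : i * (a +i* b) = (- b) +i* a.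
    by apply/eqP; rewrite /i eq_complex /=; apply/andP; split; apply/eqP; ring.
  rewrite (gC (- b) a); apply/eqP; rewrite eq_complex /=.
  by apply/andP; split; apply/eqP; ring.
have bF : bounded_linear F.
  split=> //; exists (k + k)%:C => x.
  have -> : F x = (g x)%:C + (- i) * (g (i *: x))%:C.
    rewrite /F; apply/eqP; move: (g (i *: x)) => t; rewrite eq_complex /=.
    by apply/andP; split; apply/eqP; ring.
  apply: (le_trans (ler_normD _ _)).
  have ni : `|i| = 1 by rewrite normc_def /= expr0n expr1n add0r sqrtr1.
  rewrite normrM normrN ni mul1r rmorphD mulrDl lerD //.
    by rewrite normc_real -rnormE -rmorphM lecR gN.
  rewrite normc_real (_ : `|x| = `|i *: x|); last by rewrite normrZ ni mul1r.
  by rewrite -rnormE -rmorphM lecR gN.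
have ReIm (z : C) : complex.Re z +i* (- complex.Re (i * z)) = z.
  case: z => a b; apply/eqP; rewrite eq_complex /=.
  by apply/andP; split; apply/eqP; ring.
exists (mk_dual bF) => y; rewrite [LHS]/(F _) /F.
have := gG _ (ex_intro _ y erefl); have := gG _ (ex_intro _ (i *: y) erefl).
rewrite /= (linear_Z (dual_linear f)) => -> ->.
exact: ReIm.
Qed.

End HahnBanach.

(** * Completeness of duals and of closed subspaces *)

Section Completeness.
Context {R : realType}.
Local Notation C := R[i].

Lemma cvg_norm_le (V : normedModType C) (I : Type) (F : set_system I)
    {FF : ProperFilter F} (u : I -> V) (l : V) (M : C) :
  u i @[i --> F] --> l -> (\forall i \near F, `|u i| <= M) -> `|l| <= M.
Proof.
move=> /cvgrPdist_lt ul uM; apply/ler_addgt0Pr => e e0.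
have [i [li iM]] := filter_ex (filterI (ul _ e0) uM).
rewrite -[l](subrK (u i)) addrC (le_trans (ler_normD _ _)) //.
by rewrite lerD // ltW.
Qed.

Lemma Im_mulNi (z : C) : complex.Im z = complex.Re ((0 -i* 1) * z).
Proof. by case: z => a b /=; ring. Qed.

(** The imaginary part of [z] is the real part of [- i z]
    ([Im_mulNi]), so one argument handles both coordinates. *)
Lemma complex_complete (F : set_system C^o) : ProperFilter F -> cauchy F -> cvg F.
Proof.
move=> FF /cauchyP Fc.
have ReF (w : C) : `|w| = 1 -> cvg (complex.Re (w * z) @[z --> F]).
  move=> w1; apply: cauchy_cvg; apply: cauchy_exP => e e0.
  have e0' : 0 < e%:C by rewrite ltcR.
  have [z Fz] := Fc _ e0'.
  exists (complex.Re (w * z)).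
  suff : F [set y : C^o | ball (complex.Re (w * z)) e (complex.Re (w * y))] by [].
  apply: filterS Fz => y.
  rewrite -!ball_normE /= -ltcR; apply: le_lt_trans.
  have <- : complex.Re (w * (z - y)) = complex.Re (w * z) - complex.Re (w * y).
    by rewrite mulrBr raddfB.
  apply: (le_trans (normc_ge_Re _)).
  by rewrite normrM w1 mul1r.
have ni : `|0 -i* 1 : C| = 1 by rewrite normc_def /= expr0n sqrrN expr1n add0r sqrtr1.
have /cvg_ex[a /cvgrPdist_lt Fa] := ReF 1 (normr1 _).
have /cvg_ex[b /cvgrPdist_lt Fb] := ReF _ ni.
apply/cvg_ex; exists (a +i* b); apply/cvgrPdist_lt => e e0.
have e0' : 0 < complex.Re e / 2.
  by rewrite divr_gt0 // -ltcR Re_ge0K // ltW.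
have zE (z : C) : a +i* b - z = (a - complex.Re (1 * z))%:C +
    (0 +i* 1) * (b - complex.Re ((0 -i* 1) * z))%:C.
  rewrite mul1r -Im_mulNi; case: z => x y; apply/eqP; rewrite eq_complex /=.
  by apply/andP; split; apply/eqP; ring.
near=> z; rewrite zE; apply: (le_lt_trans (ler_normD _ _)).
have ni' : `|0 +i* 1 : C| = 1 by rewrite normc_def /= expr0n expr1n add0r sqrtr1.
have RD (x y : R) : (x + y)%:C = x%:C + y%:C by rewrite rmorphD.
rewrite normrM ni' [1 * `|_|]mul1r !normc_real -[e]Re_ge0K ?ltW // -RD ltcR.
rewrite [ltRHS]splitr ltrD //; near: z; [exact: Fa | exact: Fb].
Unshelve. all: by end_near. Qed.

(** Cauchy filters of functionals converge pointwise; the uniform Cauchy estimate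
    passes to the pointwise limit and becomes an estimate of operator norms. *)
Lemma dual_complete (V : normedModType C) (F : set_system (dual V)) :
  ProperFilter F -> cauchy F -> cvg F.
Proof.
move=> FF Fcauchy; have /cauchyP Fc := Fcauchy.
have /choice[l Fl] (x : V) : exists l : C^o, (phi : dual V) x @[phi --> F] --> l.
  apply/cvg_ex; apply: complex_complete; apply/cauchyP => e e0.
  have x1 : 0 < `|x| + 1 by rewrite ltr_pwDr.
  have [phi Fphi] : exists phi : dual V, F (ball phi (e / (`|x| + 1))).
    exact: Fc (divr_gt0 e0 x1).
  exists (phi x).
  suff : F [set psi : dual V | ball (phi x : C^o) e (psi x)] by [].
  apply: filterS Fphi => psi; rewrite -!ball_normE /= => phipsi.
  apply: (le_lt_trans (opnorm_ub (phi - psi) x)).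
  apply: (le_lt_trans (ler_wpM2r (normr_ge0 x) (ltW phipsi))).
  by rewrite mulrAC ltr_pdivrMr // ltr_pM2l // ltrDl.
have Fdist (e : C) : 0 < e ->
    \forall phi \near F, forall x, `|dual_fun phi x - l x : C^o| <= e * `|x|.
  have /cauchy_ballP Fb := Fcauchy.
  move=> /Fb/nearP_dep; apply: filterS => phi Fphi x.
  have phil : (dual_fun phi x - dual_fun psi x : C^o) @[psi --> F] -->
      (dual_fun phi x - l x : C^o).
    by apply: cvgB; [exact: cvg_cst | exact: Fl].
  apply: (cvg_norm_le phil).
  apply: filterS Fphi => psi; rewrite -ball_normE /= => /ltW phipsi.
  exact: le_trans (opnorm_ub (phi - psi) x) (ler_wpM2r (normr_ge0 x) phipsi).
have ll : linear l.
  move=> a x y; apply: (cvg_unique (@norm_hausdorff _ C^o) (Fl _)) => /=.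
  rewrite (_ : (fun _ => _) = fun phi : dual V => a *: (phi x : C^o) + phi y).
    exact: cvgD (cvgZl_tmp (Fl x)) (Fl y).
  by apply/funext => phi; rewrite (dual_linear phi).
have [phi0 phi0l] := filter_ex (Fdist _ ltr01).
have bl : bounded_linear l.
  split=> //; exists (1 + `|phi0|) => x.
  rewrite -[l x](subrK (phi0 x)) (le_trans (ler_normD _ _)) // mulrDl lerD //.
    by rewrite distrC.
  exact: opnorm_ub.
apply/cvg_ex; exists (mk_dual bl); apply/cvgrPdist_le => e e0.
near=> phi; rewrite distrC; apply: opnorm_le; first exact: ltW.
by near: phi; exact: Fdist.
Unshelve. all: by end_near. Qed.

End Completeness.

Section BoundedLinear.
Context {R : realType}.
Local Notation C := R[i].
Variables (V W : normedModType C).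

Lemma bounded_linear_continuous (f : V -> W) : bounded_linear f -> continuous f.
Proof.
move=> bf x; have [k k0 fk] := bounded_linear_real bf; have [fl _] := bf.
apply/cvgrPdist_lt => e e0.
have k1 : 0 < 1 + k%:C by rewrite ltr_pwDl // lecR.
near=> y; rewrite -(linear_B fl) (le_lt_trans (fk _)) //.
have xy : `|x - y| < e / (1 + k%:C).
  by near: y; apply: cvgr_dist_lt; [exact: cvg_id | exact: divr_gt0].
apply: (le_lt_trans (ler_wpM2l _ (ltW xy))); first by rewrite lecR.
by rewrite mulrA ltr_pdivrMr // mulrC ltr_pM2l // ltr_pwDl // lexx.
Unshelve. all: by end_near. Qed.

Lemma bounded_linear_cvg (f : V -> W) (I : Type) (F : set_system I) {FF : Filter F}
    (u : I -> V) (l : V) :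
  bounded_linear f -> u i @[i --> F] --> l -> f (u i) @[i --> F] --> f l.
Proof.
by move=> bf; apply: continuous_cvg; exact: bounded_linear_continuous.
Qed.

Lemma mk_subsp_bounded (S : submodClosed W) (f : V -> W) (fS : forall x, f x \in S) :
  bounded_linear f -> bounded_linear (fun x => mk_subsp (fS x)).
Proof.
move=> [fl [k fk]].
by split=> [a x y|]; [exact: mk_subsp_comb (fl a x y) | exists k].
Qed.

Lemma closed_subsp_complete (S : submodClosed V) :
    (forall F : set_system V, ProperFilter F -> cauchy F -> cvg F) ->
    closed [set x : V | x \in S] ->
  forall F : set_system (subsp S), ProperFilter F -> cauchy F -> cvg F.
Proof.
move=> Vc Scl F FF /cauchyP Fc.
have /cvg_ex[l Fl] : cvg (val x @[x --> F]).
  apply: Vc; apply: cauchy_exP => e /Fc[x Fx]; exists (val x).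
  suff : F [set y : subsp S | ball (val x) e (val y)] by [].
  by apply: filterS Fx => y; rewrite -!ball_normE.
have lS : l \in S.
  by apply: (closed_cvg _ Scl _ _ Fl); apply: nearW => x; exact: valP.
apply/cvg_ex; exists (mk_subsp lS); apply/cvgrPdist_lt => e e0.
by move/cvgrPdist_lt : Fl => /(_ e e0).
Qed.

(** The carrier is [subsp S] itself, so that a bimodule over the normed space
    [subsp S] is, by conversion, a bimodule over this Banach space. *)
Definition closed_subsp_banach (S : submodClosed V)
    (Vc : forall F : set_system V, ProperFilter F -> cauchy F -> cvg F)
    (Scl : closed [set x : V | x \in S]) : completeNormedModType C :=
  HB.pack (subsp S)
    (Uniform_isComplete.Build (subsp S) (closed_subsp_complete Vc Scl)).

End BoundedLinear.

(** * Weak-star continuous functionals and the sigma-WC part of a bimodule *)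

Section WeakStar.
Context {R : realType}.
Local Notation C := R[i].
Variables (A : banachAlgType R) (Ast : predual A).

Definition common_kernel (s : seq (subsp Ast)) : set A :=
  [set a | forall phi, phi \in s -> dual_fun (val phi) a = 0].
Local Notation K := common_kernel.

Lemma common_kernel_filter : Filter (filter_from setT K).
Proof.
apply: filter_fromT_filter; first by exists [::].
move=> s t; exists (s ++ t) => a Ka.
by split=> phi phis; apply: Ka; rewrite mem_cat phis ?orbT.
Qed.

Lemma regular_scaleE (a : C) (z : C^o) : a *: z = (a * z : C).
Proof. by []. Qed.

(** Finite intersections of kernels generate a filter finer than that of the
    weak-star neighbourhoods of [0]; it suffices for linear functionals and involves
    no radii. *)
Lemma common_kernel_cvg : filter_from setT K --> (0 : weak_star_alg Ast).
Proof.
have FF := common_kernel_filter.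
apply/cvg_sup => phi B; rewrite nbhsE => -[U [[D oD <-] D0] UB].
exists [:: phi] => // a Ka; apply: UB; rewrite /preimage /= (Ka phi) ?mem_head //.
by move: D0; rewrite /preimage /= (linear_0 (dual_linear (val phi))).
Qed.

(** By continuity at [0] the functional is bounded by [1] on some common kernel; as
    that kernel is a subspace, the functional vanishes there. *)
Lemma weak_star_kernels (f : A -> C^o) : linear f ->
    continuous (f : weak_star_alg Ast -> C^o) ->
  exists s, forall a, K s a -> f a = 0.
Proof.
move=> fl fc.
have FF := common_kernel_filter.
have : f a @[a --> filter_from setT K] --> f 0.
  exact: cvg_trans (cvg_app _ common_kernel_cvg) (fc 0).
rewrite (linear_0 fl) => /cvgrPdist_lt/(_ 1 ltr01)[s _ Ks].
exists s => a Ka; apply/eqP; apply: contraT => fa0.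
have := Ks ((f a)^-1 *: a); rewrite /= (linear_Z fl) sub0r normrN.
rewrite regular_scaleE mulVf // normr1 ltxx => -> // phi /Ka.
by rewrite (linear_Z (dual_linear (val phi))) => ->; rewrite scaler0.
Qed.

(** Induction on [s]: if some [a0] in the common kernel of the tail is not killed by
    the head [psi], subtracting from [f] the multiple of [psi] that agrees with it at
    [a0] gives a functional vanishing on the common kernel of the tail; otherwise
    [psi] imposes no further condition. *)
Lemma kernels_span (s : seq (subsp Ast)) (f : A -> C^o) : linear f ->
    (forall a, K s a -> f a = 0) ->
  exists2 phi : dual A, phi \in Ast & forall a, phi a = f a.
Proof.
elim: s f => [|psi s IH] f fl fs.
  by exists 0; [exact: rpred0 | move=> a; rewrite fs].
have [[a0 [Ka0 psi0]]|all0] := pselect (exists a, K s a /\ dual_fun (val psi) a <> 0).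
  pose c : C := f a0 / dual_fun (val psi) a0.
  have psi0' : dual_fun (val psi) a0 != 0 by apply/eqP.
  have [||phi phiA phiE] := IH (fun a => f a - c *: (dual_fun (val psi) a : C^o)).
  - move=> t x y; rewrite fl (dual_linear (val psi)) scalerDr opprD scalerBr.
    rewrite [_ *: (t *: _)]scalerA [c * t]mulrC -scalerA.
    by rewrite -!addrA; congr (_ + _); rewrite addrCA.
  - move=> a Ka.
    have /fs : K (psi :: s)
        (a - (dual_fun (val psi) a / dual_fun (val psi) a0) *: a0).
      move=> phi; rewrite inE (linear_B (dual_linear (val phi))).
      rewrite (linear_Z (dual_linear (val phi))).
      move=> /predU1P[->|phis]; last by rewrite Ka // Ka0 // scaler0 subr0.
      by rewrite regular_scaleE divfK // subrr.
    rewrite (linear_B fl) (linear_Z fl) => fa; rewrite -[RHS]fa; congr (_ - _).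
    by rewrite !regular_scaleE /c mulrAC [RHS]mulrAC [f a0 * _]mulrC.
  exists (phi + c *: val psi); last first.
    move=> a; rewrite [LHS]/(phi a + c *: (dual_fun (val psi) a : C^o)) phiE.
    exact: subrK.
  by apply: rpredD => //; apply: rpredZ; exact: valP.
apply: IH => // a Ka; apply: fs => phi; rewrite inE => /predU1P[->|]; last exact: Ka.
by apply: contrapT => psia; apply: all0; exists a.
Qed.

(** A weak-star continuous functional vanishes on a finite intersection of kernels,
    hence is a linear combination of elements of the predual. *)
Theorem predualP (phi : dual A) :
  phi \in Ast <-> continuous (phi : weak_star_alg Ast -> C^o).
Proof.
split; first exact: weak_star_alg_continuous.
move=> /(weak_star_kernels (dual_linear phi))[s /(kernels_span (dual_linear phi))].
by move=> [psi psiA psiE]; have -> : phi = psi by apply: dual_ext.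
Qed.

Variables (X : normedModType C) (M : bimodule A X).

(** The coefficient functionals [a |-> psi (a . x)] and [a |-> psi (x . a)].  They
    depend linearly and boundedly on [x], which reduces topological conditions on
    the orbit of [x] to membership in the predual. *)
Definition left_coefficient (psi : dual X) (x : X) : dual A :=
  mk_dual (bounded_linear_comp (dual_bounded psi)
    (bounded_bilinearl x (lact_bounded M))).

Definition right_coefficient (psi : dual X) (x : X) : dual A :=
  mk_dual (bounded_linear_comp (dual_bounded psi)
    (bounded_bilinearr x (ract_bounded M))).

Lemma left_coefficient_bounded psi : bounded_linear (left_coefficient psi).
Proof.
have [k k0 Mk] := bounded_bilinear_real (lact_bounded M).
split.
  move=> c x y; apply: dual_ext => a.
  have [Ml _ _] := lact_bounded M.
  by rewrite dual_comb /dual_fun /= Ml (dual_linear psi).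
exists (`|psi| * k%:C) => x; apply: opnorm_le => [|a].
  by rewrite !mulr_ge0 // lecR.
apply: (le_trans (opnorm_ub psi (lact M a x))).
rewrite -[leRHS]mulrA -[leRHS]mulrA ler_wpM2l ?opnorm_ge0 // (le_trans (Mk _ _)) //.
by rewrite -mulrA [`|a| * _]mulrC mulrA.
Qed.

Lemma right_coefficient_bounded psi : bounded_linear (right_coefficient psi).
Proof.
have [k k0 Mk] := bounded_bilinear_real (ract_bounded M).
split.
  move=> c x y; apply: dual_ext => a.
  have [_ Mr _] := ract_bounded M.
  by rewrite dual_comb /dual_fun /= Mr (dual_linear psi).
exists (`|psi| * k%:C) => x; apply: opnorm_le => [|a].
  by rewrite !mulr_ge0 // lecR.
apply: (le_trans (opnorm_ub psi (ract M x a))).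
rewrite -[leRHS]mulrA -[leRHS]mulrA ler_wpM2l ?opnorm_ge0 //.
by rewrite (le_trans (Mk _ _)) // mulrA.
Qed.

Lemma sigmaWCP (x : X) : x \in sigmaWC Ast M <->
  forall psi, left_coefficient psi x \in Ast /\ right_coefficient psi x \in Ast.
Proof.
split.
  move=> /asboolP[/sigma_continuousP lx /sigma_continuousP rx] psi.
  by split; apply/predualP; [exact: lx | exact: rx].
move=> H; apply/asboolP; split; apply/sigma_continuousP => psi.
  by have [/predualP] := H psi.
by have [_ /predualP] := H psi.
Qed.

(** An intersection of preimages of the closed predual under continuous maps. *)
Lemma sigmaWC_closed : closed [set x | x \in sigmaWC Ast M].
Proof.
have -> : [set x | x \in sigmaWC Ast M] = \bigcap_(psi in [set: dual X])
   ((left_coefficient psi @^-1` [set phi | phi \in Ast]) `&`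
    (right_coefficient psi @^-1` [set phi | phi \in Ast])).
  by apply/seteqP; split=> x => [/sigmaWCP H psi _|H]; [|apply/sigmaWCP => psi];
    have [] := H psi.
apply: closed_bigI => psi _; apply: closedI; apply: preimage_closed;
  try exact: predual_closed; move=> x _; apply: bounded_linear_continuous.
  exact: left_coefficient_bounded.
exact: right_coefficient_bounded.
Qed.

End WeakStar.

(** * Functionals on projective tensor products *)

Section TensorDual.
Context {R : realType}.
Local Notation C := R[i].

(** The scalar field as a Banach space, the codomain needed to lift bilinear forms. *)
Definition complex_banach : completeNormedModType C :=
  HB.pack (C^o) (Uniform_isComplete.Build C^o (@complex_complete R)).

Variables (V W : normedModType C) (T : projective_tensor V W).

Lemma dual_tens_ext (f g : dual T) :
  (forall x y, f (tens T x y) = g (tens T x y)) -> f = g.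
Proof.
move=> fg; apply: dual_ext => u; congr (_ u).
exact: (@tens_ext R V W T complex_banach f g (dual_bounded f) (dual_bounded g)).
Qed.

(** Currying: a bounded trilinear form is a bounded linear family of functionals on
    the tensor product of the last two variables. *)
Lemma tens_trilinear (Y : normedModType C) (B : Y -> V -> W -> C^o) (k : R) :
    (forall y, bilinear_map (B y)) -> (forall x z, linear (fun y => B y x z)) ->
    0 <= k -> (forall y x z, `|B y x z| <= k%:C * `|y| * `|x| * `|z|) ->
  exists2 G : Y -> dual T, bounded_linear G &
    forall y x z, G y (tens T x z) = B y x z.
Proof.
move=> Bb Bl k0 Bk.
have /choice[G GP] y : exists f : dual T,
    `|f| <= k%:C * `|y| /\ forall x z, f (tens T x z) = B y x z.
  have k0' : 0 <= k * rnorm y by rewrite mulr_ge0 ?rnorm_ge0.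
  have Bk' (x : V) (z : W) : `|B y x z| <= (k * rnorm y)%:C * `|x| * `|z|.
    by rewrite RCM rnormE.
  have [bf fk fE] := @tens_liftP R V W T complex_banach (B y) _ (Bb y) k0' Bk'.
  exists (mk_dual bf); split; last exact: fE.
  apply: opnorm_le => [|u]; first by rewrite mulr_ge0 // lecR.
  by have := fk u; rewrite RCM rnormE.
exists G; last by move=> y x z; have [_] := GP y.
split; last by exists k%:C => y; have [] := GP y.
move=> a y y'; apply: dual_tens_ext => x z; rewrite dual_comb.
have [_ ->] := GP (a *: y + y'); have [_ ->] := GP y; have [_ ->] := GP y'.
exact: Bl.
Qed.

End TensorDual.

(** * From a virtual diagonal to approximately inner derivations *)

Section Sufficiency.
Context {R : realType}.
Local Notation C := R[i].
Variables (A : banachAlgType R) (Ast : predual A).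
Variables (Y : normedModType C) (M : bimodule A Y).

Local Notation DM := (dual_bimodule M).

(** Evaluating the orbits of a functional [phi] at [y] gives the coefficient
    functionals of [y] at [phi], with the two sides exchanged; normality and
    sigma-WC membership are thus the same family of conditions. *)
Lemma normal_dual_bimoduleP :
  normal_dual_bimodule Ast M <-> forall y, y \in sigmaWC Ast M.
Proof.
split=> [nM y|nM phi].
  apply/sigmaWCP => phi; have [/sigma_continuousP l /sigma_continuousP r] := nM phi.
  by split; apply/predualP; [exact: r | exact: l].
split; apply/sigma_continuousP => y; have /sigmaWCP/(_ phi)[l r] := nM y.
  exact: (weak_star_alg_continuous r).
exact: (weak_star_alg_continuous l).
Qed.

Hypothesis M_normal : normal_dual_bimodule Ast M.
Variable D : A -> dual Y.
Hypothesis D_der : derivation DM D.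
Hypothesis D_continuous : continuous (D : weak_star_alg Ast -> weak_star_topology Y).

(** Multiplying [D e = e . D e + D e . e] by [e] shows [e . D e . e = 0], so the
    commutator of [a] with [D e . e] is [- D e . a], and
    [D a = D (e a) = e . D a + D e . a]. *)
Lemma derivation_unit (e : A) (he : forall a, bmul e a = a /\ bmul a e = a) a :
  let w := ract DM (D e) e in
  lact DM e (D a) - (lact DM a w - ract DM w a) = D a.
Proof.
have [_ DE] := D_der; move=> w.
have [Ll _ _] := lact_bounded DM.
have ew0 : lact DM e w = 0.
  have := congr1 (lact DM e) (DE e e).
  rewrite (he e).1 (linear_D (Ll e)) -lactA (he e).1.
  by move=> /eqP; rewrite -subr_eq0 opprD addrA subrr sub0r oppr_eq0 => /eqP.
have -> : lact DM a w = 0.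
  by rewrite -[a](he a).2 lactA ew0 (linear_0 (Ll a)).
by rewrite sub0r opprK /w -ractA (he a).1 -DE (he a).1.
Qed.

Variable T : projective_tensor A A.
Local Notation TM := (dual_bimodule (tens_bimodule T)).
Local Notation WC := (sigmaWC Ast TM).
Local Notation N := (dual_bimodule (sigmaWC_bimodule Ast TM)).

Lemma derivation_forms : exists2 G : Y -> dual T, bounded_linear G &
  forall y b c, G y (tens T b c) = D c (ract M y b).
Proof.
have [[Dl _] _] := D_der.
have [k k0 Dk] := bounded_linear_real D_der.1.
have [l l0 Ml] := bounded_bilinear_real (ract_bounded M).
have [Mr1 Mr2 _] := ract_bounded M.
apply: (@tens_trilinear _ _ _ T Y (fun y b c => D c (ract M y b)) (k * l)).
- move=> y; split=> [b t c c'|c t b b']; first by rewrite Dl dual_comb.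
  by rewrite Mr1 (dual_linear (D c)).
- by move=> b c t y y'; rewrite Mr2 (dual_linear (D c)).
- exact: mulr_ge0.
- move=> y b c; apply: (le_trans (opnorm_ub (D c) _)).
  apply: (le_trans (ler_pM (opnorm_ge0 _) (normr_ge0 _) (Dk c) (Ml y b))).
  by rewrite RCM -subr_ge0 [X in 0 <= X](_ : _ = 0) //; ring.
Qed.

Section Forms.
Variable G : Y -> dual T.
Hypothesis G_bounded : bounded_linear G.
Hypothesis GE : forall y b c, G y (tens T b c) = D c (ract M y b).

Lemma forms_ract y a : ract TM (G y) a = G (ract M y a).
Proof.
apply: dual_tens_ext => b c; rewrite -[LHS]/(G y (tens_lact a (tens T b c))).
by have [_ _ ->] := tens_lactP T a; rewrite !GE ractA.
Qed.

(** The Leibniz rule for [D (c a)]: the map [G] fails to commute with the left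
    action by a term which factors through [Delta]. *)
Lemma forms_lact y a : lact TM a (G y) =
  G (lact M a y) + adjoint (Delta_bounded T) (right_coefficient M (D a) y).
Proof.
apply: dual_tens_ext => b c; rewrite -[LHS]/(G y (tens_ract (tens T b c) a)).
have [_ _ ->] := tens_ractP T a; rewrite GE D_der.2.
rewrite -[RHS]/(G (lact M a y) (tens T b c) + D a (ract M y (Delta (tens T b c)))).
rewrite GE; have [_ _ ->] := DeltaP T.
rewrite ractA [RHS]addrC lract.
by [].
Qed.

Lemma right_coefficient_predual y (phi : dual Y) : right_coefficient M phi y \in Ast.
Proof. by have /normal_dual_bimoduleP/(_ y)/sigmaWCP/(_ phi)[] := M_normal. Qed.

Lemma left_coefficient_predual y (phi : dual Y) : left_coefficient M phi y \in Ast.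
Proof. by have /normal_dual_bimoduleP/(_ y)/sigmaWCP/(_ phi)[] := M_normal. Qed.

(** A functional [Psi] on the dual of the tensor square pulls back along [G] to a
    functional on [Y], whose coefficients lie in the predual by normality.  The
    extra term of [forms_lact] is [a |-> D a (y . c)] for the element [c] of [A]
    that represents [Psi] on the predual, and is weak-star continuous because [D]
    is. *)
Lemma forms_sigmaWC y : G y \in WC.
Proof.
apply/sigmaWCP => Psi; split; last first.
  suff -> : right_coefficient TM Psi (G y) =
      right_coefficient M (adjoint G_bounded Psi) y.
    exact: right_coefficient_predual.
  by apply: dual_ext => a; congr (dual_fun Psi _); exact: forms_ract.
pose F := mk_dual (bounded_linear_comp (dual_bounded Psi) (Delta_adj_bounded T Ast)).
pose c : A := predual_inv F.
have ev_bounded : bounded_linear (fun a => D a (ract M y c) : C^o).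
  have [Dl Db] := D_der.1; split; first by move=> t a b; rewrite Dl dual_comb.
  have [k k0 Dk] := bounded_linear_real D_der.1.
  exists (k%:C * `|ract M y c|) => a; apply: (le_trans (opnorm_ub (D a) _)).
  by rewrite mulrAC ler_wpM2r //; exact: Dk.
suff -> : left_coefficient TM Psi (G y) =
    left_coefficient M (adjoint G_bounded Psi) y + mk_dual ev_bounded.
  apply: rpredD; first exact: left_coefficient_predual.
  by apply/predualP; move/sigma_continuousP: D_continuous; apply.
apply: dual_ext => a.
rewrite -[LHS]/(Psi (lact TM a (G y))) forms_lact (linear_D (dual_linear Psi)).
congr (_ + _).
exact: esym (predual_invK F (mk_subsp (right_coefficient_predual y (D a)))).
Qed.

Definition form (y : Y) : subsp WC := mk_subsp (forms_sigmaWC y).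

Lemma form_bounded : bounded_linear form.
Proof. exact: (mk_subsp_bounded _ G_bounded). Qed.

(** The basic identity: the commutator of [a] with the average [x] of [D] over [m] is
    the average of the commutator of [a] with [m], plus the diagonal term
    [Delta m . D a]. *)
Lemma averaged_derivation (m : dual (subsp WC)) a :
  let x := adjoint form_bounded m in
  lact DM a x - ract DM x a =
  adjoint form_bounded (lact N a m - ract N m a) + lact DM (Delta_sigmaWC m) (D a).
Proof.
move=> x; apply: dual_ext => y.
rewrite -[LHS]/(m (form (ract M y a)) - m (form (lact M a y))).
rewrite -[RHS]/(m (ract (sigmaWC_bimodule Ast TM) (form y) a) -
  m (lact (sigmaWC_bimodule Ast TM) a (form y)) + D a (ract M y (Delta_sigmaWC m))).
have -> : ract (sigmaWC_bimodule Ast TM) (form y) a = form (ract M y a).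
  by apply: val_inj; exact: forms_ract.
pose psi : subsp Ast := mk_subsp (right_coefficient_predual y (D a)).
have -> : lact (sigmaWC_bimodule Ast TM) a (form y) =
    form (lact M a y) + mk_subsp (adjoint_Delta_sigmaWC T (valP psi)).
  by apply: val_inj; exact: forms_lact.
rewrite (linear_D (dual_linear m)) -Delta_sigmaWCE opprD addrA.
exact: esym (subrK _ _).
Qed.

End Forms.

Theorem virtual_diagonal_approximately_inner (e : A)
    (he : forall a, bmul e a = a /\ bmul a e = a) (m : net (dual (subsp WC))) :
  approximate_sigmaWC_virtual_diagonal e m -> approximately_inner DM D.
Proof.
move=> [m0 me]; have [G bG GE] := derivation_forms.
pose w := ract DM (D e) e.
pose bF := form_bounded bG GE.
pose x i := adjoint bF (m i) - w.
exists (@Net (dual Y) (net_index m) (@net_le _ m) x (net_inhabited m)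
  (@net_refl _ m) (@net_trans _ m) (@net_directed _ m)) => a.
have [Ll _ _] := lact_bounded DM; have [_ Rl _] := ract_bounded DM.
have xE i : adjoint bF (lact N a (m i) - ract N (m i) a) +
    lact DM (Delta_sigmaWC (m i)) (D a) - (lact DM a w - ract DM w a) =
    lact DM a (x i) - ract DM (x i) a.
  rewrite /x (linear_B (Ll a)) (linear_B (Rl a)) -averaged_derivation.
  by rewrite !opprD opprK addrACA.
suff : (adjoint bF (lact N a (m i) - ract N (m i) a) +
    lact DM (Delta_sigmaWC (m i)) (D a) - (lact DM a w - ract DM w a))
    @[i --> tails m] --> D a.
  by apply: cvg_trans; apply: near_eq_cvg; apply: nearW => i; exact: xE.
rewrite -[X in _ --> X](derivation_unit he).
apply: cvgB; last exact: cvg_cst.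
rewrite -[X in _ --> X]add0r; apply: cvgD.
  rewrite -(linear_0 (adjoint_linear bF)).
  exact: bounded_linear_cvg (adjoint_bounded bF) (m0 a).
exact: bounded_linear_cvg (bounded_bilinearl (D a) (lact_bounded DM)) me.
Qed.

End Sufficiency.

Lemma adjointE (R : realType) (V W : normedModType R[i]) (f : V -> W)
  (bf : bounded_linear f) (phi : dual W) x : adjoint bf phi x = phi (f x).
Proof. by []. Qed.

(** * Inner derivations and twisted bimodules *)

Section InnerDerivation.
Context {R : realType}.
Local Notation C := R[i].
Variables (A : banachAlgType R) (X : normedModType C) (M : bimodule A X).

Definition inner_derivation (x : X) (a : A) : X := lact M a x - ract M x a.

Lemma inner_derivationP x : derivation M (inner_derivation x).
Proof.
have [Ll _ _] := lact_bounded M; have [_ Rl _] := ract_bounded M; split.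
  have -> : inner_derivation x = (- 1) *: ract M x + (lact M)^~ x.
    by apply/funext => a; rewrite !fctE scaleN1r addrC.
  apply: bounded_linear_comb.
    exact: bounded_bilinearr (ract_bounded M).
  exact: bounded_bilinearl (lact_bounded M).
move=> a b; rewrite /inner_derivation (linear_B (Ll a)) (linear_B (Rl b)).
by rewrite lactA ractA lract addrA subrK.
Qed.

End InnerDerivation.

Section TwistedBimodule.
Context {R : realType}.
Local Notation C := R[i].
Variables (A : banachAlgType R) (X : normedModType C) (M : bimodule A X).
Variables (Q : X -> X) (Q_bounded : bounded_linear Q).
Hypothesis Q_ract : forall x a, Q (ract M x a) = ract M (Q x) a.
Hypothesis Q_lact : forall a x, Q (lact M a (Q x)) = Q (lact M a x).

(** The hypotheses make the kernel [J] of [Q] a submodule.  For an idempotent [Q] the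
    range of [Q], with the twisted left action and the given right action, is the
    quotient bimodule of [X] by [J]; keeping all of [X] as carrier avoids both the
    quotient and the subspace. *)
Definition twisted_lact (a : A) (x : X) : X := Q (lact M a x).

Lemma twisted_lact_bounded : bounded_bilinear twisted_lact.
Proof.
have [Ql _] := Q_bounded; have [q q0 Qq] := bounded_linear_real Q_bounded.
have [Ml Mr _] := lact_bounded M.
have [k k0 Mk] := bounded_bilinear_real (lact_bounded M).
split=> [a|x|].
- by move=> c x y; rewrite /twisted_lact Ml Ql.
- by move=> c a b; rewrite /twisted_lact Mr Ql.
- exists (q%:C * k%:C) => a x; apply: (le_trans (Qq _)).
  by rewrite -!mulrA ler_wpM2l ?lecR // mulrA.
Qed.

Definition twisted_bimodule : bimodule A X.
Proof.
apply: (@Bimodule _ A X twisted_lact (ract M) twisted_lact_bounded (ract_bounded M)).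
- by move=> a b x; rewrite /twisted_lact lactA Q_lact.
- exact: ractA.
- by move=> a x b; rewrite /twisted_lact -Q_ract lract.
Defined.

Local Notation N := (dual_bimodule M).
Local Notation DT := (dual_bimodule twisted_bimodule).

Lemma twisted_dual_ract (m : dual X) a :
  ract DT m a = ract N (adjoint Q_bounded m) a.
Proof. exact: dual_ext. Qed.

Lemma adjoint_dual_lact (m : dual X) a :
  adjoint Q_bounded (lact N a m) = lact N a (adjoint Q_bounded m).
Proof. by apply: dual_ext => x; congr (dual_fun m _); rewrite -Q_ract. Qed.

Lemma adjoint_dual_ract (m : dual X) a :
  adjoint Q_bounded (ract N (adjoint Q_bounded m) a) =
  ract N (adjoint Q_bounded m) a.
Proof. by apply: dual_ext => x; congr (dual_fun m _); exact: Q_lact. Qed.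

Section InnerTwist.
(* [m0] implements an inner derivation whose values annihilate the kernel of [Q]. *)
Variable m0 : dual X.
Hypothesis m0_fixed :
  forall a, adjoint Q_bounded (inner_derivation N m0 a) = inner_derivation N m0 a.

(** On functionals fixed by the adjoint of [Q], the twisted action agrees with the
    original one. *)
Lemma twisted_inner_derivation : derivation DT (inner_derivation N m0).
Proof.
have [bD DE] := inner_derivationP N m0; split=> // a b.
by rewrite twisted_dual_ract m0_fixed DE.
Qed.

(** The adjoint of [Q] turns commutators for the twisted dual action into commutators
    for the original one. *)
Lemma twisted_correction m a :
  adjoint Q_bounded (inner_derivation N m0 a - inner_derivation DT m a) =
  inner_derivation N (m0 - adjoint Q_bounded m) a.
Proof.
have [Ll _ _] := lact_bounded N; have [_ Rl _] := ract_bounded N.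
have Ql := adjoint_linear Q_bounded.
rewrite (linear_B Ql) m0_fixed /inner_derivation (linear_B Ql).
rewrite twisted_dual_ract adjoint_dual_ract [adjoint _ (lact _ _ _)]adjoint_dual_lact.
by rewrite (linear_B (Ll a)) (linear_B (Rl a)) !opprD !opprK addrACA.
Qed.

Lemma twisted_correction_cvg (m : net (dual X)) a :
  inner_derivation DT (m i) a @[i --> tails m] --> inner_derivation N m0 a ->
  inner_derivation N (m0 - adjoint Q_bounded (m i)) a @[i --> tails m] --> 0.
Proof.
move=> mD; have c : inner_derivation N m0 a - inner_derivation DT (m i) a
    @[i --> tails m] --> 0.
  by rewrite -(subrr (inner_derivation N m0 a)); apply: cvgB mD; exact: cvg_cst.
under eq_fun do rewrite -twisted_correction.
rewrite -(linear_0 (adjoint_linear Q_bounded)).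
exact: bounded_linear_cvg (adjoint_bounded Q_bounded) c.
Qed.

End InnerTwist.

Lemma twisted_sigmaWC (Ast : predual A) x :
  x \in sigmaWC Ast M -> x \in sigmaWC Ast twisted_bimodule.
Proof.
move=> /sigmaWCP xM; apply/sigmaWCP => psi; split; last by have [_] := xM psi.
suff -> : left_coefficient twisted_bimodule psi x =
    left_coefficient M (adjoint Q_bounded psi) x.
  by have [] := xM (adjoint Q_bounded psi).
exact: dual_ext.
Qed.

End TwistedBimodule.

(** * The sigma-WC part as a bimodule of its own *)

Section SigmaWCIdempotent.
Context {R : realType}.
Local Notation C := R[i].
Variables (A : banachAlgType R) (Ast : predual A).

(** The canonical map into the dual of the predual is isometric. *)
Lemma predual_separates (a b : A) :
  (forall phi : subsp Ast, dual_fun (val phi) a = dual_fun (val phi) b) -> a = b.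
Proof.
move=> ab; apply/eqP; rewrite -subr_eq0 -normr_eq0 -(predual_isometry Ast).
rewrite normr_eq0; apply/eqP; apply: dual_ext => phi.
rewrite -[LHS]/(dual_fun (val phi) (a - b)) (linear_B (dual_linear (val phi))) ab.
exact: subrr.
Qed.

(** A functional on the subspace extends to the whole space by [hahn_banach], and
    then has the same coefficients as its extension. *)
Lemma sigmaWC_sigmaWC (X : normedModType C) (M : bimodule A X)
  (x : subsp (sigmaWC Ast M)) : x \in sigmaWC Ast (sigmaWC_bimodule Ast M).
Proof.
apply/sigmaWCP => psi; have [Psi PsiE] := hahn_banach psi.
have /sigmaWCP/(_ Psi)[l r] := valP x; split.
  suff -> : left_coefficient (sigmaWC_bimodule Ast M) psi x =
    left_coefficient M Psi (val x) by [].
  by apply: dual_ext => a; exact: esym (PsiE (lact (sigmaWC_bimodule Ast M) a x)).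
suff -> : right_coefficient (sigmaWC_bimodule Ast M) psi x =
  right_coefficient M Psi (val x) by [].
by apply: dual_ext => a; exact: esym (PsiE (ract (sigmaWC_bimodule Ast M) x a)).
Qed.

End SigmaWCIdempotent.

(** * From approximate Connes-amenability to a virtual diagonal *)

Section Necessity.
Context {R : realType}.
Local Notation C := R[i].
Variables (A : banachAlgType R) (Ast : predual A) (T : projective_tensor A A).
Variables (e : A) (he : forall a, bmul e a = a /\ bmul a e = a).

Local Notation TM := (dual_bimodule (tens_bimodule T)).
Local Notation WC := (sigmaWC Ast TM).
Local Notation SB := (sigmaWC_bimodule Ast TM).
Local Notation N := (dual_bimodule SB).
Local Notation ee := (tens T e e).

Definition Delta_adjoint (phi : subsp Ast) : subsp WC :=
  mk_subsp (adjoint_Delta_sigmaWC T (valP phi)).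

Lemma Delta_adjoint_bounded : bounded_linear Delta_adjoint.
Proof. exact: (mk_subsp_bounded _ (Delta_adj_bounded T Ast)). Qed.

Lemma Delta_tens_unit : Delta ee = e.
Proof. by have [_ _ ->] := DeltaP T; rewrite (he e).1. Qed.

Lemma bidual_evaluation_bounded (u : T) :
  bounded_linear (fun F : dual T => F u : C^o).
Proof.
by split=> //; exists `|u| => F; rewrite mulrC; exact: opnorm_ub.
Qed.

Definition bidual_evaluation u : dual (dual T) :=
  mk_dual (bidual_evaluation_bounded u).

Lemma slice_predual (F : subsp WC) :
  right_coefficient TM (bidual_evaluation ee) (val F) \in Ast.
Proof. by have /sigmaWCP/(_ (bidual_evaluation ee))[] := valP F. Qed.

(** The partial evaluation [a |-> F (a (x) e)], a left inverse of the adjoint of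
    [Delta] because [e] is an identity.  It lies in the predual since
    [a (x) e = a . (e (x) e)] and [F] belongs to [WC]. *)
Definition slice (F : subsp WC) : subsp Ast := mk_subsp (slice_predual F).

Lemma slice_bounded : bounded_linear slice.
Proof.
apply: (mk_subsp_bounded slice_predual).
exact: bounded_linear_comp (right_coefficient_bounded TM (bidual_evaluation ee))
  (subsp_val_bounded WC).
Qed.

Lemma slice_Delta_adjoint phi : slice (Delta_adjoint phi) = phi.
Proof.
apply/val_inj/dual_ext => a.
rewrite -[LHS]/(dual_fun (val phi) (Delta (tens_lact a ee))).
by rewrite Delta_lact Delta_tens_unit (he a).2.
Qed.

(** The projection of [WC] along the range of the adjoint of [Delta]. *)
Definition deflate (F : subsp WC) : subsp WC := F - Delta_adjoint (slice F).

Lemma deflate_bounded : bounded_linear deflate.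
Proof.
have -> : deflate = (- 1) *: (Delta_adjoint \o slice) + idfun.
  by apply/funext => F; rewrite !fctE scaleN1r addrC.
apply: bounded_linear_comb; last by split=> //; exists 1 => x; rewrite mul1r.
exact: bounded_linear_comp Delta_adjoint_bounded slice_bounded.
Qed.

Lemma deflate_Delta_adjoint phi : deflate (Delta_adjoint phi) = 0.
Proof. by rewrite /deflate slice_Delta_adjoint subrr. Qed.

Lemma lact_Delta_adjoint a phi : exists psi,
  lact SB a (Delta_adjoint phi) = Delta_adjoint psi.
Proof.
exists (mk_subsp (predual_lact a (valP phi))); apply/val_inj/dual_ext => u.
exact: (congr1 (dual_fun (val phi)) (Delta_ract u a)).
Qed.

(** The range of the adjoint of [Delta] is a submodule, so replacing [F] by
    [deflate F] changes [a . F] by an element which [deflate] kills. *)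
Lemma deflate_lact a F : deflate (lact SB a (deflate F)) = deflate (lact SB a F).
Proof.
have [Ll _ _] := lact_bounded SB; have [Ql _] := deflate_bounded.
have [psi E] := lact_Delta_adjoint a (slice F).
by rewrite {2}/deflate (linear_B (Ll a)) (linear_B Ql) E deflate_Delta_adjoint subr0.
Qed.

(** Both sides subtract the functional [u |-> F (a . Delta u (x) e)]. *)
Lemma deflate_ract F a : deflate (ract SB F a) = ract SB (deflate F) a.
Proof.
have [_ Rl _] := ract_bounded SB.
rewrite /deflate (linear_B (Rl a)); congr (_ - _); apply/val_inj/dual_ext => u.
rewrite -[LHS]/(dual_fun (val F) (tens_lact a (tens_lact (Delta u) ee))).
rewrite -[RHS]/(dual_fun (val F) (tens_lact (Delta (tens_lact a u)) ee)).
by rewrite -tens_lactA Delta_lact.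
Qed.

(** A diagonal that fails only to be invariant. *)
Definition unit_evaluation : dual (subsp WC) := evaluation WC ee.
Local Notation E := unit_evaluation.
Local Notation Q' := (adjoint deflate_bounded).
Local Notation D := (inner_derivation N E).
Local Notation TW := (twisted_bimodule deflate_bounded deflate_ract deflate_lact).

Lemma commutatorE a (F : subsp WC) : dual_fun (D a) F =
  dual_fun (val F) (tens_lact a ee) - dual_fun (val F) (tens_ract ee a).
Proof. by []. Qed.

(** [Delta] maps both [a . (e (x) e)] and [(e (x) e) . a] to [a]. *)
Lemma commutator_Delta_adjoint a phi : dual_fun (D a) (Delta_adjoint phi) = 0.
Proof.
rewrite commutatorE.
rewrite -[LHS]/(dual_fun (val phi) (Delta (tens_lact a ee)) -
  dual_fun (val phi) (Delta (tens_ract ee a))).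
by rewrite Delta_lact Delta_ract Delta_tens_unit (he a).1 (he a).2 subrr.
Qed.

Lemma commutator_deflate a : Q' (D a) = D a.
Proof.
apply: dual_ext => F; rewrite adjointE /deflate.
rewrite (linear_B (dual_linear (D a))) commutator_Delta_adjoint.
exact: subr0.
Qed.
Lemma commutator_continuous :
  continuous (D : weak_star_alg Ast -> weak_star_topology (subsp WC)).
Proof.
apply/sigma_continuousP => F.
have /sigmaWCP/(_ (bidual_evaluation ee))[l r] := valP F.
rewrite (_ : (fun _ => _) = dual_fun
    (right_coefficient TM (bidual_evaluation ee) (val F) -
     left_coefficient TM (bidual_evaluation ee) (val F))) //.
apply/predualP; apply: rpredD => //.
by rewrite -scaleN1r; exact: rpredZ.
Qed.

Theorem approximately_Connes_amenable_virtual_diagonal :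
  approximately_Connes_amenable Ast ->
  exists m : net (dual (subsp WC)), approximate_sigmaWC_virtual_diagonal e m.
Proof.
move=> ACA.
pose Y := closed_subsp_banach (@dual_complete _ T) (@sigmaWC_closed _ _ Ast _ TM).
have normal : normal_dual_bimodule Ast TW.
  by apply/normal_dual_bimoduleP => F; apply: twisted_sigmaWC; exact: sigmaWC_sigmaWC.
have [x xD] := ACA Y TW normal D
  (twisted_inner_derivation deflate_ract deflate_lact commutator_deflate)
  commutator_continuous.
pose m i := E - Q' (x i).
exists (@Net (dual (subsp WC)) (net_index x) (@net_le _ x) m (net_inhabited x)
  (@net_refl _ x) (@net_trans _ x) (@net_directed _ x)); split=> [a|].
  exact: (twisted_correction_cvg commutator_deflate (xD a)).
suff mE i : Delta_sigmaWC (m i) = e.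
  by rewrite (_ : (fun _ => _) = cst e); [exact: cvg_cst | apply/funext].
apply: (predual_separates (Ast := Ast)) => phi; rewrite Delta_sigmaWCE.
rewrite -[LHS]/(dual_fun (val phi) (Delta ee) -
  dual_fun (x i : dual (subsp WC)) (deflate (Delta_adjoint phi))).
by rewrite deflate_Delta_adjoint Delta_tens_unit (linear_0 (dual_linear (x i))) subr0.
Qed.

End Necessity.

Theorem theorem3p3 (R : realType) (A : banachAlgType R) (Ast : predual A)
    (T : projective_tensor A A) (e : A)
    (he : forall a : A, bmul e a = a /\ bmul a e = a) :
  approximately_Connes_amenable Ast <->
  exists M : net (dual (subsp (sigmaWC Ast (dual_bimodule (tens_bimodule T))))),
    approximate_sigmaWC_virtual_diagonal e M.
Proof.
split; first exact: approximately_Connes_amenable_virtual_diagonal.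
move=> [m mV] Y M M_normal D D_der D_continuous.
exact: (virtual_diagonal_approximately_inner M_normal D_der D_continuous he mV).
Qed.
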